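(* Let $a,c$ be real numbers with $a\neq 0,1$ and $c\neq 0,-1,-2,\ldots$. Let $\mathcal F=(F_1,F_2)$ be a pair of finite sets of positive integers with $F_2\neq\emptyset$, let $k_2=|F_2|$, $k=|F_1|+|F_2|$, let $f_{k_2}^2=\max F_2$, and let $\mathcal F'=(F_1,F_2\setminus\{f_{k_2}^2\})$. Define the first order difference operators $$A_{\mathcal F}=\frac{\Omega_{\mathcal F}(x+1)}{a\,\Omega_{\mathcal F'}(x+1)}\mathfrak s_0-\frac{\Omega_{\mathcal F}(x)}{\Omega_{\mathcal F'}(x+1)}\mathfrak s_1,$$ $$B_{\mathcal F}=\frac{ax\,\Omega_{\mathcal F'}(x+1)}{(a-1)\Omega_{\mathcal F}(x)}\mathfrak s_{-1}-\frac{a(x+c+k-1)\,\Omega_{\mathcal F'}(x)}{(a-1)\Omega_{\mathcal F}(x)}\mathfrak s_0 .$$ Then $m_n^{\mathcal F}=A_{\mathcal F}\big(m_{n-f_{k_2}^2+k_2-1}^{\mathcal F'}\big)$ for $n\in\sigma_{\mathcal F}$. Moreover $$D_{\mathcal F'}=B_{\mathcal F}A_{\mathcal F}-(c+f_{k_2}^2-u_{\mathcal F'})\,Id,\qquad D_{\mathcal F}=A_{\mathcal F}B_{\mathcal F}-(c+f_{k_2}^2-u_{\mathcal F})\,Id .$$ In other words, the system $(D_{\mathcal F},(m_n^{\mathcal F})_{n\in\sigma_{\mathcal F}})$ can be obtained by applying a Darboux transform to the system $(D_{\mathcal F'},(m_n^{\mathcal F'})_{n\in\sigma_{\mathcal 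F'}})$.
   Context: Shift operators: $\mathfrak s_l f(x)=f(x+l)$; $\Delta f(x)=f(x+1)-f(x)$; $Id$ is the identity operator. Meixner polynomials: for $a\ne 0,1$, $m_n^{a,c}(x)=\frac{a^n}{(1-a)^n}\sum_{j=0}^n a^{-j}\binom{x}{j}\binom{-x-c}{n-j}$. For a pair $\mathcal H=(H_1,H_2)$ of finite sets of positive integers, let $k_i=|H_i|$, $k=k_1+k_2$, $$u_{\mathcal H}=\sum_{f\in H_1}f+\sum_{f\in H_2}f-\binom{k_1+1}{2}-\binom{k_2}{2},\qquad \sigma_{\mathcal H}=\{u_{\mathcal H},u_{\mathcal H}+1,\ldots\}\setminus\{u_{\mathcal H}+f: f\in H_1\}.$$ For $n\in\sigma_{\mathcal H}$, $m_n^{\mathcal H}(x)=m_n^{a,c;\mathcal H}(x)$ is the determinant of the $(k+1)\times(k+1)$ matrix with columns indexed by $j=0,\ldots,k$ whose rows are, from top to bottom: $\big(m_{n-u_{\mathcal H}}^{a,c}(x+j)\big)_j$; then $\big(m_f^{a,c}(x+j)\big)_j$ for $f\in H_1$ (increasing order); then $\big(m_f^{1/a,c}(x+j)/a^j\big)_j$ for $f\in H_2$ (increasing order). $\Omega_{\mathcal H}(x)=\Omega_{\mathcal H}^{a,c}(x)$ is the $k\times k$ determinant with columns indexed by $j=0,\ldots,k-1$ and rows $\big(m_f^{a,c}(x+j)\big)_j$ for $f\in H_1$ (increasing order), followed by $\big(m_f^{1/a,c}(x+j)/a^j\big)_j$ for $f\in H_2$ (increasing order). $\Lambda_{\mathcal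 H}(x)$ is the $k\times k$ determinant defined in the same way but with columns indexed by $j=0,\ldots,k-2,k$. $D_{\mathcal H}=h_{-1}\mathfrak s_{-1}+h_0\mathfrak s_0+h_1\mathfrak s_1$ with $$h_{-1}(x)=\frac{x\,\Omega_{\mathcal H}(x+1)}{(a-1)\Omega_{\mathcal H}(x)},\qquad h_1(x)=\frac{a(x+c+k)\,\Omega_{\mathcal H}(x)}{(a-1)\Omega_{\mathcal H}(x+1)},$$ $$h_0(x)=-\frac{(1+a)(x+k)+ac}{a-1}+u_{\mathcal H}+\Delta\left(\frac{a(x+c+k-1)\Lambda_{\mathcal H}(x)}{(a-1)\Omega_{\mathcal H}(x)}\right).$$ Convention for $\mathcal H=(\emptyset,\emptyset)$: $u_{\mathcal H}=0$, $\sigma_{\mathcal H}=\mathbb N=\{0,1,2,\ldots\}$, $\Omega_{\mathcal H}=1$, $\Lambda_{\mathcal H}=0$, $m_n^{\mathcal H}=m_n^{a,c}$. Darboux transform: given an operator $T$ with eigenfunctions $\phi_n$, $T\phi_n=\pi_n\phi_n$, and a factorization $T=BA+\lambda Id$ with $A,B$ first order operators, the Darboux transform with parameter $\lambda$ is the system formed by $\hat T=AB+\lambda Id$ and $\hat\phi_n=A\phi_n$ (so that $\hat T\hat\phi_n=\pi_n\hat\phi_n$). In the lemma above, the systems are compared up to the index shift $n\mapsto n-f_{k_2}^2+k_2-1$ and the corresponding additive constant in the operator. *)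

(* Defs.v *)
From HB Require Import structures.
From mathcomp Require Import all_boot all_order all_algebra.
From mathcomp Require Import finmap.

Set Implicit Arguments.
Unset Strict Implicit.
Unset Printing Implicit Defensive.

Import GRing.Theory.
Local Open Scope ring_scope.
Local Open Scope quotient_scope.

Notation ratfun R := {fraction {poly R}}.
Notation tofrac := (@FracField.tofrac _).

Section Shift.
Variable R : fieldType.

Definition pshift (l : int) (p : {poly R}) : {poly R} :=
  p \Po ('X + (l%:~R)%:P).

(* The value does not depend on the chosen representative: see [fshift_div]. *)
Definition fshift (l : int) (g : ratfun R) : ratfun R :=
  tofrac (pshift l \n_(repr g)) / tofrac (pshift l \d_(repr g)).

Lemma pshift_eq0 l p : (pshift l p == 0) = (p == 0).
Proof. exact: comp_poly2_eq0 (size_XaddC _). Qed.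

Lemma pshiftM l : {morph pshift l : p q / p * q}.
Proof. by move=> p q; rewrite /pshift comp_polyM. Qed.

Lemma fshift_div l (p q : {poly R}) : q != 0 ->
  fshift l (tofrac p / tofrac q) = tofrac (pshift l p) / tofrac (pshift l q).
Proof.
move=> q0; rewrite /fshift; set g := tofrac p / tofrac q.
have d0 : \d_(repr g) != 0 := denom_ratioP _.
have gE : g = tofrac \n_(repr g) / tofrac \d_(repr g).
  apply: (canRL (mulfK _)); first by rewrite tofrac_eq0.
  unlock FracField.tofrac; rewrite -{1}[g]reprK -[LHS]FracField.pi_mul.
  apply/eqmodP; rewrite /= FracField.equivfE /FracField.mulf.
  by rewrite !numden_Ratio ?mulf_neq0 ?oner_neq0 // !mulr1 mulrC.
have : tofrac (p * \d_(repr g)) = tofrac (\n_(repr g) * q).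
  rewrite !tofracM; apply/eqP; rewrite -eqr_div ?tofrac_eq0 //; apply/eqP.
  by rewrite -gE.
move/eqP; rewrite tofrac_eq => /eqP/(congr1 (pshift l)); rewrite !pshiftM => e.
apply/eqP; rewrite eqr_div ?tofrac_eq0 ?pshift_eq0 //.
by rewrite -!tofracM -e mulrC.
Qed.

Lemma fshift_tofrac l (p : {poly R}) :
  fshift l (tofrac p) = tofrac (pshift l p).
Proof.
have := fshift_div l p (oner_neq0 _).
by rewrite tofrac1 divr1 /pshift rmorph1 tofrac1 divr1.
Qed.

Definition ratc (r : R) : ratfun R := tofrac r%:P.

Definition fwd (g : ratfun R) : ratfun R := fshift 1 g - g.

End Shift.

Section Meixner.
Variable R : fieldType.

Definition binom_poly (p : {poly R}) (j : nat) : {poly R} :=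
  (j`!%:R)^-1 *: \prod_(i < j) (p - (i%:R)%:P).

Definition meixner (a c : R) (n : nat) : {poly R} :=
  (a ^+ n / (1 - a) ^+ n) *:
  \sum_(j < n.+1)
     a ^- j *: (binom_poly 'X j * binom_poly (- 'X - c%:P) (n - j)).

End Meixner.

Section Exceptional.
Variables (R : fieldType) (a c : R).
Implicit Type H : {fset nat} * {fset nat}.

Definition cardH1 H : nat := #|` H.1|.
Definition cardH2 H : nat := #|` H.2|.
Definition cardH H : nat := (cardH1 H + cardH2 H)%N.

(* For sets of positive integers the natural-number subtractions are exact:
   k distinct positive integers add up to at least 'C(k.+1, 2). *)
Definition uH H : nat :=
  (\sum_(f <- H.1) f + \sum_(f <- H.2) f
     - 'C((cardH1 H).+1, 2) - 'C(cardH2 H, 2))%N.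

Definition sigmaH H : pred nat :=
  [pred n | (uH H <= n)%N && (n \notin [seq (uH H + f)%N | f <- H.1])].

(* A row is the map sending a column label j to the corresponding entry. *)
Definition rows H : seq (nat -> {poly R}) :=
  [seq (fun j : nat => pshift j (meixner a c f)) | f <- sort leq H.1] ++
  [seq (fun j : nat => a ^- j *: pshift j (meixner a^-1 c f))
     | f <- sort leq H.2].

Definition det_rows (k : nat) (rs : seq (nat -> {poly R})) (col : nat -> nat) :
    {poly R} :=
  \det (\matrix_(i < k, j < k) nth (fun=> 0) rs i (col j)).

Definition meixnerH H (n : nat) : {poly R} :=
  det_rows (cardH H).+1
    ((fun j : nat => pshift j (meixner a c (n - uH H))) :: rows H) id.

Definition Omega H : {poly R} := det_rows (cardH H) (rows H) id.

(* Column labels 0, ..., k-2, k; by convention Lambda = 0 when k = 0. *)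
Definition Lambda H : {poly R} :=
  let k := cardH H in
  if k == 0%N then 0
  else det_rows k (rows H) (fun j => if j == k.-1 then k else j).

Definition OmegaF H (l : int) : ratfun R := fshift l (tofrac (Omega H)).

Definition h_m1 H : ratfun R :=
  tofrac 'X * OmegaF H 1 / (ratc (a - 1) * OmegaF H 0).

Definition h_1 H : ratfun R :=
  ratc a * tofrac ('X + (c + (cardH H)%:R)%:P) * OmegaF H 0
    / (ratc (a - 1) * OmegaF H 1).

Definition h_0 H : ratfun R :=
  - (tofrac ((1 + a) *: ('X + ((cardH H)%:R)%:P) + (a * c)%:P)
       / ratc (a - 1))
  + ratc (uH H)%:R
  + fwd (ratc a * tofrac ('X + (c + (cardH H)%:R - 1)%:P) * tofrac (Lambda H)
           / (ratc (a - 1) * OmegaF H 0)).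

Definition DH H (g : ratfun R) : ratfun R :=
  h_m1 H * fshift (-1) g + h_0 H * fshift 0 g + h_1 H * fshift 1 g.

Definition max2 H : nat := \max_(f <- H.2) f.
Definition rem_max2 H : {fset nat} * {fset nat} := (H.1, H.2 `\ max2 H)%fset.

Definition AF H (g : ratfun R) : ratfun R :=
  OmegaF H 1 / (ratc a * OmegaF (rem_max2 H) 1) * fshift 0 g
  - OmegaF H 0 / OmegaF (rem_max2 H) 1 * fshift 1 g.

Definition BF H (g : ratfun R) : ratfun R :=
  ratc a * tofrac 'X * OmegaF (rem_max2 H) 1 / (ratc (a - 1) * OmegaF H 0)
    * fshift (-1) g
  - ratc a * tofrac ('X + (c + (cardH H)%:R - 1)%:P) * OmegaF (rem_max2 H) 0
      / (ratc (a - 1) * OmegaF H 0)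
    * fshift 0 g.

End Exceptional.

Section Darboux.
Variable R : fieldType.

Record diffsystem := DiffSystem {
  sop : ratfun R -> ratfun R;
  sidx : pred nat;
  sfun : nat -> ratfun R }.

Definition eigensystem (X : diffsystem) : Prop :=
  exists eigv : nat -> R, forall n, n \in sidx X ->
    sfun X n != 0 /\ sop X (sfun X n) = ratc (eigv n) * sfun X n.

Definition first_order (T : ratfun R -> ratfun R) : Prop :=
  exists (l : int) (u v : ratfun R),
    [/\ u != 0, v != 0 & forall g, T g = u * fshift l g + v * fshift (l + 1) g].

(* [Y] is the Darboux transform of [X] with parameter [lam] given by the
   factorization [sop X = B A + lam Id]. *)
Definition darboux_transform (A B : ratfun R -> ratfun R) (lam : R)
    (X Y : diffsystem) : Prop :=
  [/\ eigensystem X,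
      first_order A /\ first_order B,
      forall g, sop X g = B (A g) + ratc lam * g,
      forall g, sop Y g = A (B g) + ratc lam * g
    & sidx Y =i sidx X /\ forall n, n \in sidx X -> sfun Y n = A (sfun X n)].

(* [Y] is [X] relabelled along the bijection [tau] from the indices of [Y] onto
   those of [X], with the constant [d] added to the operator. *)
Definition reindexed (tau : nat -> nat) (d : R) (X Y : diffsystem) : Prop :=
  [/\ forall g, sop Y g = sop X g + ratc d * g,
      {in sidx Y &, injective tau},
      forall n, n \in sidx X <-> exists2 m, m \in sidx Y & tau m = n
    & forall m, m \in sidx Y -> sfun Y m = sfun X (tau m)].

Definition meixner_system (a c : R) (H : {fset nat} * {fset nat}) :=
  DiffSystem (DH a c H) (sigmaH H) (fun n => tofrac (meixnerH a c H n)).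

End Darboux.

(* Main.v *)
(** A Meixner polynomial [m_f^{a,c}], and likewise [a^{-x} m_f^{1/a,c}], is an
    eigenfunction ("seed") of the second order operator [D] of the empty pair.
    Let [L_F] be the difference operator sending [y] to the determinant with
    first row [y(x+j)] and the seeds of [F] below it.  Its coefficients at the
    two ends are [Omega] and [Lambda] up to sign, so that [D_F L_F] and
    [L_F (D + u_F)] agree in all but [k] consecutive orders, and both kill the
    [k] seeds; as the Casoratian of the seeds is nonzero, they are equal.
    The same argument gives [L_F = A_F L_{F'}], the seeds of [F] being those of
    [F'] followed by the one for [max F_2].  The outer coefficients of
    [B_F A_F + lambda] and [D_{F'}] agree, and so do their values at the image
    of this last seed under [L_{F'}], which [A_F] kills; hence they coincide.
    For [A_F B_F + lambda] and [D_F] one compares the values at some nonzero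
    [m_n^F] instead. *)

Require Import Defs.
From HB Require Import structures.
From mathcomp Require Import all_boot all_order all_algebra.
From mathcomp Require Import finmap reals.
From mathcomp Require Import ring zify.
Set Implicit Arguments.
Unset Strict Implicit.
Unset Printing Implicit Defensive.
Import Order.TTheory GRing.Theory Num.Theory.
Local Open Scope ring_scope.


(** * Casoratian determinants over a field with an endomorphism *)

Section ShiftField.
Variables (K : fieldType) (sig : {rmorphism K -> K}).

Definition rowdet (k : nat) (rs : seq (nat -> K)) (col : nat -> nat) : K :=
  \det (\matrix_(i < k, j < k) nth (fun=> 0) rs i (col j)).

(* The pair [(b, p)] stands for the function x |-> b ^ x * p x; dividing by
   b ^ x keeps all values in [K]. *)
Definition trow (u : K * K) (j : nat) : K := u.1 ^+ j * iter j sig u.2.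

Definition cas (s : seq (K * K)) : K := rowdet (size s) (map trow s) id.

(** The operator [L_F] for the seeds [s], applied to [b ^ x * y x] and divided by [b ^ x]. *)
Definition casop (s : seq (K * K)) (b y : K) : K :=
  rowdet (size s).+1 (trow (b, y) :: map trow s) id.

(** Since [bump j] skips the label [j], this is a cofactor of the first row of [casop]: the
    coefficient of order [j] of that operator. *)
Definition ccof (s : seq (K * K)) (j : nat) : K :=
  (-1) ^+ j * rowdet (size s) (map trow s) (bump j).

Lemma eq_rowdet k rs rs' col col' :
  (forall i j, (i < k)%N -> (j < k)%N ->
     nth (fun=> 0) rs i (col j) = nth (fun=> 0) rs' i (col' j)) ->
  rowdet k rs col = rowdet k rs' col'.
Proof.
move=> e; rewrite /rowdet; congr (\det _).
by apply/matrixP => i j; rewrite !mxE e.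
Qed.

Lemma casopE s b y :
  casop s b y = \sum_(j < (size s).+1) ccof s j * trow (b, y) j.
Proof.
rewrite /casop /rowdet (expand_det_row _ ord0); apply: eq_bigr => j _.
rewrite mxE /= mulrC; congr (_ * _).
rewrite /cofactor /ccof add0n; congr (_ * _); rewrite /rowdet; congr (\det _).
by apply/matrixP => i1 j1; rewrite !mxE /=.
Qed.


Lemma nth_rows_rcons s t i :
  nth (fun=> 0) (map trow (rcons s t)) i =
  if (i < size s)%N then nth (fun=> 0) (map trow s) i
  else if i == size s then trow t else fun=> 0.
Proof. by rewrite map_rcons nth_rcons size_map. Qed.

(** Moving the last row to the top costs [size s] transpositions; the proof expands one determinant
    along its last row and the other along its first. *)
Lemma cas_rcons s t :
  cas (rcons s t) = (-1) ^+ size s * casop s t.1 t.2.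
Proof.
rewrite casopE mulr_sumr /cas size_rcons /rowdet (expand_det_row _ ord_max).
apply: eq_bigr => j _.
rewrite mxE nth_rows_rcons /= ltnn eqxx.
rewrite -surjective_pairing mulrC /cofactor /ccof exprD -!mulrA.
do 3! congr (_ * _); congr (\det _).
by apply/matrixP => i1 j1; rewrite !mxE nth_rows_rcons lift_max ltn_ord.
Qed.

Lemma casop_mem s b p : (b, p) \in s -> casop s b p = 0.
Proof.
move=> /(nthP (0, 0))[i lti ei].
have lt1 : (i.+1 < (size s).+1)%N by [].
apply: (determinant_alternate (i1 := ord0) (i2 := Ordinal lt1)) => // j.
by rewrite !mxE /= (nth_map (0, 0)) // ei.
Qed.

Lemma ccof_size s : ccof s (size s) = (-1) ^+ size s * cas s.
Proof.
rewrite /ccof; congr (_ * _); apply: eq_rowdet => i j _ ltj.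
by rewrite /bump leqNgt ltj.
Qed.

Lemma iterM j (x y : K) : iter j sig (x * y) = iter j sig x * iter j sig y.
Proof. by elim: j => //= j ->; rewrite rmorphM. Qed.

Lemma sig_trow u j : sig u.1 = u.1 -> trow u j.+1 = u.1 * sig (trow u j).
Proof. by move=> e; rewrite /trow iterS rmorphM rmorphXn e exprS mulrA. Qed.

Definition const (x : K) := sig x = x.

Definition seeds (s : seq (K * K)) :=
  forall u, u \in s -> const u.1 /\ u.1 != 0.

(** Without column [0], each row is the shift of a row of the Casoratian times the base of its seed;
    a diagonal matrix collects the bases. *)
Lemma ccof0 s : seeds s -> ccof s 0 = (\prod_(u <- s) u.1) * sig (cas s).
Proof.
move=> hs; rewrite /ccof expr0 mul1r /cas /rowdet -det_map_mx /=.
rewrite (big_nth (0, 0)) big_mkord.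
rewrite -[X in _ = X * _](_ : \det (diag_mx (\row_(i < size s) (nth (0,0) s i).1)) = _);
  last by rewrite det_diag; apply: eq_bigr => i _; rewrite mxE.
rewrite -det_mulmx; congr (\det _); apply/matrixP => i j.
rewrite mul_diag_mx !mxE !(nth_map (0,0)) // /bump leq0n add1n sig_trow //.
by have [] := hs _ (mem_nth (0,0) (ltn_ord i)).
Qed.

(** The coefficients of an operator of order less than [size s] that kills all seeds solve a square
    homogeneous system whose determinant is the Casoratian. *)
Lemma kernel_eq0 s (e : nat -> K) : cas s != 0 ->
  (forall u, u \in s -> \sum_(j < size s) e j * trow u j = 0) ->
  forall j, (j < size s)%N -> e j = 0.
Proof.
move=> s0 h; set M := \matrix_(i < size s, j < size s) nth (fun=> 0) (map trow s) i (id j).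
have uM : M \in unitmx by rewrite unitmxE unitfE.
have M0 : M *m (\col_j e j) = 0.
  apply/matrixP => i j; rewrite !mxE -[RHS](h (nth (0,0) s i)) ?mem_nth //.
  by apply: eq_bigr => k _; rewrite !mxE (nth_map (0,0)) // mulrC.
have v0 : \col_j e j = 0 :> 'cV_(size s) by rewrite -[LHS](mulKmx uM) M0 mulmx0.
by move=> j ltj; move/matrixP: v0 => /(_ (Ordinal ltj) 0); rewrite !mxE.
Qed.

End ShiftField.

(** * Darboux-Crum intertwining and factorization of second order difference operators *)

Section Crum.
Variables (K : fieldType) (sig sig' : {rmorphism K -> K}).
Hypotheses (sigK : cancel sig sig') (sig'K : cancel sig' sig).

(** The second order operator with coefficients [A], [B], [C] at the shifts -1, 0, 1, applied to
    [b ^ x * y x] and divided by [b ^ x]. *)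
Definition jac (A B C b y : K) : K :=
  A * (b^-1 * sig' y) + B * y + C * (b * sig y).

(* Minor with columns 0, ..., k-2, k. *)
Definition skipcas (s : seq (K * K)) : K :=
  if size s == 0%N then 0
  else rowdet (size s) (map (trow sig) s) (bump (size s).-1).

(** If [casop] intertwines [jac A B C] with another such operator, comparing the lowest order forces
    [crumA], and the two highest orders force [crumC] and [crumB]. [crumG] is the expression whose
    difference enters [h_0]. *)
Definition crumA (A : K) s := A * sig (cas sig s) / cas sig s.
Definition crumC (C : K) s :=
  iter (size s) sig C * cas sig s / sig (cas sig s).
Definition crumG (C : K) s := iter (size s).-1 sig C * skipcas s / cas sig s.
Definition crumB (B C : K) s :=
  iter (size s) sig B + (sig (crumG C s) - crumG C s).

Lemma const_sig' b : const sig b -> sig' b = b.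
Proof. by move=> e; rewrite -[in LHS]e sigK. Qed.

Lemma const_iter b j : const sig b -> iter j sig b = b.
Proof. by move=> e; elim: j => //= j ->. Qed.

Lemma trowM b x y j : trow sig (b, x * y) j = iter j sig x * trow sig (b, y) j.
Proof. by rewrite /trow /= iterM mulrCA. Qed.

Lemma trowD b x y j :
  trow sig (b, x + y) j = trow sig (b, x) j + trow sig (b, y) j.
Proof.
rewrite /trow /= -mulrDr; congr (_ * _).
by elim: j => //= j ->; rewrite rmorphD.
Qed.

Lemma trow_back b y j : const sig b -> b != 0 ->
  trow sig (b, b^-1 * sig' y) j.+1 = trow sig (b, y) j.
Proof.
move=> cb b0; rewrite /trow /= -iterS iterSr rmorphM fmorphV cb sig'K.
rewrite iterM exprS const_iter; last by rewrite /const fmorphV cb.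
by field.
Qed.

Lemma trow_forw b y j : const sig b ->
  trow sig (b, b * sig y) j = trow sig (b, y) j.+1.
Proof. by move=> cb; rewrite trowM const_iter // /trow exprS -iterSr mulrA. Qed.

Lemma casopZ s b x y : const sig x -> casop sig s b (x * y) = x * casop sig s b y.
Proof.
move=> cx; rewrite !casopE mulr_sumr; apply: eq_bigr => j _.
by rewrite trowM const_iter // mulrCA.
Qed.

(** The hypotheses say that the total coefficients of [Y 0], [Y k.+2] and [Y k.+1] vanish, which
    leaves [k] consecutive terms. *)
Lemma banded_sum (e0 e1 e2 : nat -> K) k :
  e0 0%N = 0 -> e2 k = 0 -> e1 k + (if k is k'.+1 then e2 k' else 0) = 0 ->
  exists c : nat -> K, forall Y : nat -> K,
    \sum_(j < k.+1) (e0 j * Y j + e1 j * Y j.+1 + e2 j * Y j.+2)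
    = \sum_(j < k) c j * Y j.+1.
Proof.
move=> h0 h2 h1; pose f j := if j is j'.+1 then e2 j' else 0.
exists (fun j => e0 j.+1 + e1 j + f j) => Y.
rewrite !big_split /= big_ord_recl h0 mul0r add0r /=.
have -> : \sum_(j < k.+1) e2 j * Y j.+2 = \sum_(j < k.+1) f j * Y j.+1.
  by rewrite big_ord_recr /= h2 mul0r addr0 [RHS]big_ord_recl /= mul0r add0r.
rewrite -addrA -big_split big_ord_recr /= -mulrDl h1 mul0r addr0 -big_split.
by apply: eq_bigr => j _ /=; rewrite !mulrDl addrA.
Qed.

Lemma ccof_pred s k : size s = k.+1 -> ccof sig s k = (-1) ^+ k * skipcas s.
Proof. by move=> e; rewrite /ccof /skipcas e. Qed.

(* The two sides differ by an operator of order less than [size s] that kills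
   every seed. *)
Lemma darboux_crum (A B C : K) s b y :
  seeds sig s -> cas sig s != 0 ->
  (forall u, u \in s -> exists2 l, const sig l & jac A B C u.1 u.2 = l * u.2) ->
  const sig b -> b != 0 ->
  jac (crumA A s) (crumB B C s) (crumC C s) b (casop sig s b y)
  = casop sig s b (jac A B C b y).
Proof.
move=> hs W0 heig cb b0.
set A' := crumA A s; set B' := crumB B C s; set C' := crumC C s.
set k := size s; set W := cas sig s in W0; pose l := ccof sig s.
have sW0 : sig W != 0 by rewrite fmorph_eq0.
(* Contributions of the backward, middle and forward shifts to the difference of the two composed
   operators. *)
pose e0 j := A' * sig' (l j) - l j * iter j sig A.
pose e1 j := B' * l j - l j * iter j sig B.
pose e2 j := C' * sig (l j) - l j * iter j sig C.
have sgn n : sig ((-1) ^+ n) = (-1) ^+ n by rewrite rmorphXn rmorphN rmorph1.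
have h0 : e0 0%N = 0.
  rewrite /e0 /l ccof0 // rmorphM sigK const_sig' /=; last first.
    rewrite /const rmorph_prod big_seq [RHS]big_seq.
    by apply: eq_bigr => u /hs[].
  by rewrite /A' /crumA -/W; field.
have h2 : e2 k = 0.
  rewrite /e2 /l ccof_size rmorphM /= sgn /C' /crumC -/W -/k.
  by field.
have h1 : e1 k + (if k is k'.+1 then e2 k' else 0) = 0.
  rewrite /e1 /e2 /B' /C' /crumB /crumG /crumC /l ccof_size -/W -/k.
  (* Without seeds, [skipcas] is [0] and the correction term in [crumB] vanishes. *)
  case ek : k => [|k'] /=.
    by rewrite /skipcas -/k ek eqxx !(mulr0, mul0r) rmorph0; ring.
  have -> : sig (ccof sig s k') = (-1) ^+ k' * sig (skipcas s).
    by rewrite (ccof_pred ek) rmorphM sgn.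
  rewrite (ccof_pred ek) rmorphM fmorphV rmorphM /= exprS.
  by field; apply/andP.
have [c hc] := banded_sum h0 h2 h1.
have key b1 y1 : const sig b1 -> b1 != 0 ->
    jac A' B' C' b1 (casop sig s b1 y1) - casop sig s b1 (jac A B C b1 y1)
    = \sum_(j < k) c j * trow sig (b1, y1) j.
  (* [Y] starts one step before [y1], so that the backward shift too has a natural number as
     index. *)
  move=> cb1 b10; pose Y := trow sig (b1, b1^-1 * sig' y1).
  have YS j : Y j.+1 = trow sig (b1, y1) j by rewrite /Y trow_back.
  have cY j : Y j.+1 = b1 * sig (Y j) by rewrite /Y sig_trow.
  have -> : \sum_(j < k) c j * trow sig (b1, y1) j = \sum_(j < k) c j * Y j.+1.
    by apply: eq_bigr => j _; rewrite YS.
  have tB j : trow sig (b1, jac A B C b1 y1) j =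
      iter j sig A * Y j + iter j sig B * Y j.+1 + iter j sig C * Y j.+2.
    by rewrite /jac !trowD trowM -/(Y j) trowM -YS trowM trow_forw // -YS.
  rewrite -hc !casopE /jac !rmorph_sum /= !mulr_sumr -!big_split /= -sumrB.
  apply: eq_bigr => j _; rewrite -/(jac _ _ _ _ _) tB -!YS -/(l j).
  have -> : sig' (l j * Y j.+1) = sig' (l j) * (b1 * Y j).
    by rewrite cY [LHS]rmorphM [X in _ * X = _]rmorphM sigK (const_sig' cb1).
  rewrite [sig (l j * Y j.+1)]rmorphM.
  have -> : Y j.+2 = b1 * sig (Y j.+1) by rewrite cY.
  rewrite /e0 /e1 /e2.
  by field.
have c0 : forall j, (j < k)%N -> c j = 0.
  apply: (kernel_eq0 W0) => u us; have [cu u0] := hs _ us.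
  case: u us cu u0 => b1 p /= us cb1 b10.
  have [x cx e] := heig _ us.
  rewrite -key //= e casopZ // casop_mem // mulr0 subr0 /jac.
  by rewrite !rmorph0 !mulr0 !addr0.
apply/eqP; rewrite -subr_eq0 key // big1 // => j _.
by rewrite c0 // mul0r.
Qed.



(** [stepA] and [stepB] are [A_F] and [B_F] when the seed [t] is adjoined to those of [F']; in the
    application the base [t.1] is [1/a]. *)
Definition stepA s t (b z : K) :=
  t.1 * sig (cas sig (rcons s t)) / sig (cas sig s) * z
  - cas sig (rcons s t) / sig (cas sig s) * (b * sig z).

Definition stepB (A C : K) s t (b z : K) :=
  t.1^-1 * A * sig (cas sig s) / cas sig (rcons s t) * (b^-1 * sig' z)
  - iter (size s) sig C * cas sig s / cas sig (rcons s t) * z.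

Lemma casop_seed s t :
  casop sig s t.1 t.2 = (-1) ^+ size s * cas sig (rcons s t).
Proof. by rewrite cas_rcons mulrA -expr2 sqrr_sign mul1r. Qed.

Lemma sig_signM n x : sig ((-1) ^+ n * x) = (-1) ^+ n * sig x.
Proof. by rewrite rmorphM rmorphXn rmorphN rmorph1. Qed.

(** By [casop_seed] the argument is, up to sign, the Casoratian of [rcons s t], for which the two
    terms cancel. *)
Lemma stepA_seed s t : stepA s t t.1 (casop sig s t.1 t.2) = 0.
Proof. by rewrite casop_seed /stepA sig_signM; ring. Qed.

Lemma stepAZ s t b x z : const sig x -> stepA s t b (x * z) = x * stepA s t b z.
Proof. by move=> cx; rewrite /stepA rmorphM cx; ring. Qed.

(** Both sides have order [size s + 1] with equal top coefficients and kill all seeds of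
    [rcons s t], so [kernel_eq0] applies to their difference. *)
Lemma crum_rcons s t b y :
  seeds sig (rcons s t) -> cas sig s != 0 -> cas sig (rcons s t) != 0 ->
  const sig b -> b != 0 ->
  casop sig (rcons s t) b y = stepA s t b (casop sig s b y).
Proof.
move=> hs; set W := cas sig s; set V := cas sig (rcons s t) => W0 V0 cb b0.
have sW0 : sig W != 0 by rewrite fmorph_eq0.
have ss : size (rcons s t) = (size s).+1 by rewrite size_rcons.
pose l := ccof sig s; pose l' := ccof sig (rcons s t).
pose e0 j := l' j - t.1 * sig V / sig W * l j.
pose e1 j := V / sig W * sig (l j).
pose c j := (if (j < (size s).+1)%N then e0 j else 0)
            + (if j is j'.+1 then e1 j' else 0).
(* The top coefficients agree, so [c] lists every remaining coefficient of the difference. *)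
have e1E : l' (size s).+1 = - (V / sig W * sig (l (size s))).
  rewrite /l' -ss ccof_size ss /l ccof_size sig_signM -/V -/W exprS.
  by field.
have key b1 y1 : const sig b1 -> b1 != 0 ->
    casop sig (rcons s t) b1 y1 - stepA s t b1 (casop sig s b1 y1)
    = \sum_(j < (size s).+1) c j * trow sig (b1, y1) j.
  move=> cb1 b10; pose Y := trow sig (b1, y1).
  have YS j : Y j.+1 = b1 * sig (Y j) by rewrite /Y sig_trow.
  rewrite !casopE ss /stepA -/W -/V -/l -/l' -/Y.
  rewrite [sig (\sum_(j < _) l j * Y j)]rmorph_sum.
  rewrite !mulr_sumr -sumrB big_ord_recr /= e1E.
  have -> : \sum_(j < (size s).+1) c j * Y j =
     \sum_(j < (size s).+1) e0 j * Y j + \sum_(j < size s) e1 j * Y j.+1.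
    rewrite (_ : \sum_(j < size s) _ = \sum_(j < (size s).+1)
        (if j : nat is j'.+1 then e1 j' else 0) * Y j); last first.
      by rewrite big_ord_recl mul0r add0r.
    rewrite -big_split; apply: eq_bigr => j _.
    by rewrite /c ltn_ord mulrDl.
  have -> : \sum_(j < size s) e1 j * Y j.+1 =
     \sum_(j < (size s).+1) e1 j * Y j.+1 - e1 (size s) * Y (size s).+1.
    by rewrite big_ord_recr /= addrK.
  rewrite [LHS]addrAC -sumrB [RHS]addrA -big_split /=; congr (_ + _); last first.
    by rewrite /e1 mulNr.
  apply: eq_bigr => j _; rewrite YS /e0 /e1 [sig (l j * _)]rmorphM; ring.
have c0 : forall j, (j < (size s).+1)%N -> c j = 0.
  rewrite -ss; apply: (kernel_eq0 V0) => u us; have [cu u0] := hs _ us.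
  move: us; rewrite ss; case: u cu u0 => b1 p /= cb1 b10 us.
  rewrite -key //= casop_mem // sub0r; apply/eqP; rewrite oppr_eq0; apply/eqP.
  move: us; rewrite mem_rcons inE => /orP[/eqP<-|us]; first exact: stepA_seed.
  by rewrite casop_mem // /stepA rmorph0 !mulr0 subr0.
apply/eqP; rewrite -subr_eq0 key // big1 // => j _.
by rewrite c0 // mul0r.
Qed.

(** Once the outer coefficients are fixed, the value at one nonzero argument determines the middle
    one. *)
Lemma jac_eq A B B' C b z b1 y : z != 0 ->
  jac A B C b z = jac A B' C b z -> jac A B C b1 y = jac A B' C b1 y.
Proof.
move=> z0 /addIr/addrI /(mulIf z0) ->.
by [].
Qed.

Lemma crum_BA A B C s t lam b y :
  seeds sig (rcons s t) -> cas sig s != 0 -> cas sig (rcons s t) != 0 ->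
  (forall u, u \in rcons s t ->
     exists2 l, const sig l & jac A B C u.1 u.2 = l * u.2) ->
  const sig lam -> jac A B C t.1 t.2 = lam * t.2 ->
  const sig b -> b != 0 ->
  jac (crumA A s) (crumB B C s) (crumC C s) b y
  = stepB A C s t b (stepA s t b y) + lam * y.
Proof.
move=> hs W0 V0 heig clam et cb b0.
have sW0 : sig (cas sig s) != 0 by rewrite fmorph_eq0.
have sV0 : sig (cas sig (rcons s t)) != 0 by rewrite fmorph_eq0.
have s'V0 : sig' (cas sig (rcons s t)) != 0 by rewrite fmorph_eq0.
have [ct t0] : const sig t.1 /\ t.1 != 0 by apply: hs; rewrite mem_rcons mem_head.
pose V := cas sig (rcons s t); pose W := cas sig s.
(* The unshifted coefficient of the expanded product, plus [lam]; the outer coefficients come out as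
   [crumA] and [crumC]. *)
pose B1 := - (t.1^-1 * A * sig W / V * (sig' V / W))
           - iter (size s) sig C * W / V * (t.1 * sig V / sig W) + lam.
have BA b1 z : const sig b1 -> b1 != 0 ->
  stepB A C s t b1 (stepA s t b1 z) + lam * z
  = jac (crumA A s) B1 (crumC C s) b1 z.
  move=> cb1 b10; rewrite /stepB /stepA /jac /crumA /crumC /B1 -/V -/W.
  rewrite [sig' (_ - _)]rmorphB ![sig' (_ * _)]rmorphM !fmorphV !sigK.
  rewrite ?(const_sig' cb1) ?(const_sig' ct).
  by field; do !(apply/andP; split).
have ins u : u \in s -> u \in rcons s t by rewrite mem_rcons inE orbC => ->.
(* The test argument is the image of [t]: it is nonzero, [stepA] kills it, and by intertwining the
   left operator multiplies it by [lam]. *)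
rewrite BA //; apply: (@jac_eq _ _ _ _ t.1 (casop sig s t.1 t.2)).
  by rewrite casop_seed mulf_neq0 // signr_eq0.
rewrite -BA // stepA_seed /stepB rmorph0 !mulr0 subr0 add0r.
rewrite darboux_crum //; last by move=> u /ins /heig.
  by rewrite et casopZ.
by move=> u /ins /hs.
Qed.

(** The eigenfunction [y0] supplies the test argument: its image under [casop] for [rcons s t] is
    nonzero and, by intertwining, has eigenvalue [mu]. *)
Lemma crum_AB A B C s t lam mu b0 y0 b y :
  seeds sig (rcons s t) -> cas sig s != 0 -> cas sig (rcons s t) != 0 ->
  (forall u, u \in rcons s t ->
     exists2 l, const sig l & jac A B C u.1 u.2 = l * u.2) ->
  const sig lam -> jac A B C t.1 t.2 = lam * t.2 ->
  const sig b0 -> b0 != 0 -> const sig mu -> jac A B C b0 y0 = mu * y0 ->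
  casop sig (rcons s t) b0 y0 != 0 ->
  const sig b -> b != 0 ->
  jac (crumA A (rcons s t)) (crumB B C (rcons s t)) (crumC C (rcons s t)) b y
  = stepA s t b (stepB A C s t b y) + lam * y.
Proof.
move=> hs W0 V0 heig clam et cb0 b00 cmu ey0 y00 cb b0'.
have sW0 : sig (cas sig s) != 0 by rewrite fmorph_eq0.
have sV0 : sig (cas sig (rcons s t)) != 0 by rewrite fmorph_eq0.
have [ct t0] : const sig t.1 /\ t.1 != 0 by apply: hs; rewrite mem_rcons mem_head.
pose V := cas sig (rcons s t); pose W := cas sig s.
pose B1 := - (t.1 * sig V / sig W * (iter (size s) sig C * W / V))
           - V / sig W * (t.1^-1 * sig A * sig (sig W) / sig V) + lam.
have AB b1 z : const sig b1 -> b1 != 0 ->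
  stepA s t b1 (stepB A C s t b1 z) + lam * z
  = jac (crumA A (rcons s t)) B1 (crumC C (rcons s t)) b1 z.
  move=> cb1 b10; rewrite /stepB /stepA /jac /crumA /crumC /B1 -/V -/W size_rcons.
  rewrite [sig (_ - _)]rmorphB ![sig (_ * _)]rmorphM !fmorphV !sig'K.
  rewrite !cb1 !ct iterS.
  by field; do !(apply/andP; split).
have ins u : u \in s -> u \in rcons s t by rewrite mem_rcons inE orbC => ->.
rewrite AB //; apply: (@jac_eq _ _ _ _ b0 (casop sig (rcons s t) b0 y0)) => //.
rewrite -AB // darboux_crum // ey0 casopZ // crum_rcons //.
set z := casop sig s b0 y0.
(* [crum_BA] evaluates [stepB] after [stepA] at [z]; one more [stepA] then evaluates the reversed
   product at [stepA z]. *)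
have Dz : stepB A C s t b0 (stepA s t b0 z) = (mu - lam) * z.
  apply/eqP; rewrite mulrBl -subr_eq opprK; apply/eqP.
  rewrite -(crum_BA z hs W0 V0 heig clam et cb0 b00) darboux_crum // ?ey0 ?casopZ //.
    by move=> u /ins /hs.
  by move=> u /ins /heig.
rewrite Dz stepAZ; first by ring.
by rewrite /const rmorphB cmu clam.
Qed.

End Crum.

(** * The shifts as automorphisms of the field of rational functions *)

Lemma subf_div (K : fieldType) (x y z t : K) : y != 0 -> t != 0 ->
  x / y - z / t = (x * t - z * y) / (y * t).
Proof. by move=> y0 t0; field; apply/andP. Qed.

Section ShiftMorphism.
Variable R : fieldType.
Implicit Types (l m : int) (p q : {poly R}) (g h : ratfun R).

Lemma ratfunP g : exists p q, q != 0 /\ g = tofrac p / tofrac q.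
Proof.
have d0 : \d_(repr g)%qT != 0 := denom_ratioP _.
exists \n_(repr g)%qT, \d_(repr g)%qT; split=> //.
apply: (canRL (mulfK _)); first by rewrite tofrac_eq0.
unlock FracField.tofrac; rewrite -{1}[g]reprK -[LHS]FracField.pi_mul.
apply/eqmodP; rewrite /= FracField.equivfE /FracField.mulf.
by rewrite !numden_Ratio ?mulf_neq0 ?oner_neq0 // !mulr1 mulrC.
Qed.

Lemma pshiftD l : {morph @pshift R l : p q / p + q}.
Proof. by move=> p q; rewrite /pshift comp_polyD. Qed.

Lemma pshiftB l : {morph @pshift R l : p q / p - q}.
Proof. by move=> p q; rewrite /pshift comp_polyB. Qed.

Lemma pshift1 l : pshift l 1 = 1 :> {poly R}.
Proof. by rewrite /pshift comp_polyC. Qed.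

Lemma pshiftC l (r : R) : pshift l r%:P = r%:P.
Proof. by rewrite /pshift comp_polyC. Qed.

Lemma pshiftX l : pshift l 'X = 'X + l%:~R%:P :> {poly R}.
Proof. by rewrite /pshift comp_polyX. Qed.

Lemma pshiftZ l (r : R) p : pshift l (r *: p) = r *: pshift l p.
Proof. by rewrite /pshift comp_polyZ. Qed.

Lemma pshift_pshift l m p : pshift l (pshift m p) = pshift (l + m) p.
Proof.
rewrite /pshift -comp_polyA comp_polyD comp_polyX comp_polyC.
by rewrite -addrA -polyCD -rmorphD.
Qed.

Lemma pshift0 p : pshift 0 p = p.
Proof. by rewrite /pshift addr0 comp_polyXr. Qed.

Lemma lead_coef_pshift l p : lead_coef (pshift l p) = lead_coef p.
Proof. by rewrite /pshift lead_coef_comp ?size_XaddC // lead_coefXaddC expr1n mulr1. Qed.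

(** Together with its multiplicative counterpart, this lets [fshift 1] and [fshift (-1)] serve as
    [sig] and [sig']. *)
Lemma fshift_is_zmod_morphism l : zmod_morphism (@fshift R l).
Proof.
move=> g h; have [p [q [q0 ->]]] := ratfunP g; have [r [s [s0 ->]]] := ratfunP h.
have subE (p1 q1 r1 s1 : {poly R}) : q1 != 0 -> s1 != 0 ->
    tofrac p1 / tofrac q1 - tofrac r1 / tofrac s1
    = tofrac (p1 * s1 - r1 * q1) / tofrac (q1 * s1).
  move=> q10 s10; rewrite tofracB !tofracM.
  by apply: subf_div; rewrite tofrac_eq0.
rewrite subE // !fshift_div ?mulf_neq0 // subE ?pshift_eq0 //.
by rewrite pshiftB !pshiftM.
Qed.

HB.instance Definition _ l := GRing.isZmodMorphism.Build
  (ratfun R) (ratfun R) (@fshift R l) (fshift_is_zmod_morphism l).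

Lemma fshift_is_monoid_morphism l : monoid_morphism (@fshift R l).
Proof.
split; first by rewrite -tofrac1 fshift_tofrac pshift1.
move=> g h; have [p [q [q0 ->]]] := ratfunP g; have [r [s [s0 ->]]] := ratfunP h.
rewrite mulf_div -!tofracM !fshift_div ?mulf_neq0 // mulf_div.
by rewrite !pshiftM !tofracM.
Qed.

HB.instance Definition _ l := GRing.isMonoidMorphism.Build
  (ratfun R) (ratfun R) (@fshift R l) (fshift_is_monoid_morphism l).

Lemma fshift_fshift l m g : fshift l (fshift m g) = fshift (l + m) g.
Proof.
have [p [q [q0 ->]]] := ratfunP g.
by rewrite !fshift_div ?pshift_eq0 // !pshift_pshift.
Qed.

Lemma fshift0 g : fshift 0 g = g.
Proof.
by have [p [q [q0 ->]]] := ratfunP g; rewrite fshift_div // !pshift0.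
Qed.

Lemma fshift1K : cancel (@fshift R 1) (@fshift R (-1)).
Proof. by move=> g; rewrite fshift_fshift fshift0. Qed.

Lemma fshiftN1K : cancel (@fshift R (-1)) (@fshift R 1).
Proof. by move=> g; rewrite fshift_fshift fshift0. Qed.

Lemma iter_fshift j g : iter j (@fshift R 1) g = fshift j g.
Proof.
by elim: j => [|j IH]; rewrite ?fshift0 //= IH fshift_fshift -intS.
Qed.

Lemma fshift_ratc l (r : R) : fshift l (ratc r) = ratc r.
Proof. by rewrite /ratc fshift_tofrac pshiftC. Qed.

Lemma ratc_is_zmod_morphism : zmod_morphism (@ratc R).
Proof. by move=> x y; rewrite /ratc rmorphB tofracB. Qed.

HB.instance Definition _ := GRing.isZmodMorphism.Build
  R (ratfun R) (@ratc R) ratc_is_zmod_morphism.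

Lemma ratc_is_monoid_morphism : monoid_morphism (@ratc R).
Proof.
by split=> [|x y]; rewrite /ratc ?polyC1 ?tofrac1 ?polyCM ?tofracM.
Qed.

HB.instance Definition _ := GRing.isMonoidMorphism.Build
  R (ratfun R) (@ratc R) ratc_is_monoid_morphism.

Lemma tofracZ (r : R) p : tofrac (r *: p) = ratc r * tofrac p.
Proof. by rewrite -mul_polyC tofracM. Qed.

End ShiftMorphism.

(** * Linear dependence from a vanishing Casoratian *)

Section Dependence.
Variables (K : fieldType) (sig sig' : {rmorphism K -> K}).
Hypotheses (sig'K : cancel sig' sig).

(* Shifting the relation between the rows and subtracting gives a relation
   between the rows of [s] alone, which must be trivial. *)
Lemma cas_rcons_eq0 s t : cas sig s != 0 -> cas sig (rcons s t) = 0 ->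
  seeds sig s -> const sig t.1 ->
  exists r : 'I_(size s) -> K,
    (forall i, t.1 * sig (r i) = (nth (0, 0) s i).1 * r i) /\
    t.2 = \sum_i r i * (nth (0, 0) s i).2.
Proof.
move=> s0 st0 hs ct; set k := size s.
set M := \matrix_(i < k, j < k) nth (fun=> 0) (map (trow sig) s) i (id j).
have uM : M \in unitmx by rewrite unitmxE unitfE.
pose u i := nth (0, 0) s i.
have ME i j : M i j = trow sig (u i) j by rewrite mxE (nth_map (0, 0)).
pose v : 'rV_k := (\row_j trow sig t j) *m invmx M.
pose r i := v 0 i.
have relk j : (j < k)%N -> trow sig t j = \sum_i r i * trow sig (u i) j.
  move=> ltj; have /matrixP/(_ 0 (Ordinal ltj)) : v *m M = \row_j trow sig t j.
    by rewrite mulmxKV.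
  by rewrite !mxE => <-; apply: eq_bigr => i _; rewrite ME.
(* In the extra column [k], the defect [d] times the nonzero top cofactor equals [casop] at [t],
   which vanishes. *)
have rel j : (j < k.+1)%N -> trow sig t j = \sum_i r i * trow sig (u i) j.
  rewrite ltnS leq_eqVlt => /predU1P[->|]; last exact: relk.
  apply/eqP; rewrite -subr_eq0; set d := _ - _.
  have : casop sig s t.1 t.2 = 0.
    apply/eqP; move/eqP: st0; rewrite cas_rcons mulf_eq0 signr_eq0 //.
  have -> : casop sig s t.1 t.2 = ccof sig s k * d.
    rewrite casopE big_ord_recr /= -surjective_pairing /d mulrBr addrC.
    congr (_ + _).
    rewrite (eq_bigr (fun j : 'I_k =>
        \sum_i r i * (ccof sig s j * trow sig (u i) j))); last first.
      by move=> i _; rewrite relk // mulr_sumr; apply: eq_bigr => l _; rewrite mulrCA.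
    rewrite exchange_big mulr_sumr -sumrN; apply: eq_bigr => i _ /=.
    rewrite -mulr_sumr mulrCA -mulrN; congr (_ * _); apply/eqP.
    rewrite -addr_eq0; apply/eqP.
    rewrite -[RHS](@casop_mem _ sig s (u i).1 (u i).2); last first.
      by rewrite -surjective_pairing mem_nth.
    by rewrite casopE big_ord_recr -surjective_pairing.
  by rewrite ccof_size => /eqP; rewrite !mulf_eq0 signr_eq0 (negPf s0).
have cu i : (i < k)%N -> const sig (u i).1 /\ (u i).1 != 0.
  by move=> lti; apply: hs; rewrite mem_nth.
pose q i := t.1 * sig (r i) - (u i).1 * r i.
(* [q] is the failure of the multiplier relation, pulled back by [sig'] so that the unshifted matrix
   [M] can be inverted. *)
pose w : 'rV_k := \row_i sig' (q i).
have w0 : w = 0.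
  rewrite -[w](mulmxK uM); suff -> : w *m M = 0 by rewrite mul0mx.
  apply/matrixP => a j; rewrite [a]ord1 !mxE.
  apply: (fmorph_inj sig); rewrite rmorph0.
  rewrite (_ : sig _ = \sum_i q i * sig (trow sig (u i) j)); last first.
    rewrite rmorph_sum; apply: eq_bigr => i _.
    by rewrite mxE ME rmorphM sig'K.
  rewrite (eq_bigr (fun i => t.1 * sig (r i * trow sig (u i) j)
                             - r i * trow sig (u i) j.+1)); last first.
    move=> i _; rewrite sig_trow ?rmorphM; last by have [] := cu _ (ltn_ord i).
    by rewrite /q; ring.
  by rewrite sumrB -mulr_sumr -rmorph_sum -!rel ?sig_trow ?subrr ?ltnS ?ltn_ord // ltnW.
exists r; split=> [i|].
  move/matrixP: w0 => /(_ 0 i); rewrite !mxE => /(congr1 sig).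
  by rewrite sig'K rmorph0 => /eqP; rewrite subr_eq0 => /eqP.
have := rel 0%N isT; rewrite {1}/trow expr0 mul1r /= => ->.
by apply: eq_bigr => i _; rewrite /trow expr0 mul1r.
Qed.

End Dependence.

(** * Nonvanishing of Casoratians of polynomial seeds *)

Section Casoratian.
Variable R : numFieldType.
Implicit Types (p q : {poly R}) (g : ratfun R).

Definition fseed (u : R * {poly R}) : ratfun R * ratfun R :=
  (ratc u.1, tofrac u.2).

(** Periodicity of [p / q] propagates to all natural shifts, so the difference of the two sides has
    the infinitely many roots [x + m]. *)
Lemma poly_periodic_ratio p q x : q.[x] != 0 ->
  pshift 1 p * q = p * pshift 1 q -> p.[x] *: q = q.[x] *: p.
Proof.
move=> qx e.
have em m : pshift (Posz m) p * q = p * pshift (Posz m) q.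
  have q0 : q != 0 by apply: contraNneq qx => ->; rewrite horner0.
  elim: m => [|m IH]; first by rewrite !pshift0.
  apply: (@mulIf _ (pshift m q)); first by rewrite pshift_eq0.
  have := congr1 (pshift m) e; rewrite !pshiftM !pshift_pshift -PoszD addn1 => e'.
  rewrite -mulrA [q * _]mulrC mulrA e' -mulrA [pshift _ q * q]mulrC mulrA IH.
  by rewrite -!mulrA [_ * pshift m q]mulrC.
apply/eqP; rewrite -subr_eq0; apply: contraT => d0.
set d := _ - _ in d0.
have rt m : root d (x + m%:R).
  have := congr1 (horner^~ x) (em m); rewrite /pshift !hornerM !horner_comp !hornerE.
  rewrite /root /d !hornerE => e2; apply/eqP; rewrite -[m%:R]/(m%:~R) -e2; ring.
have := max_poly_roots d0 (rs := [seq x + m%:R | m <- iota 0 (size d)]).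
rewrite size_map size_iota ltnn => -> //.
  by apply/allP => _ /mapP[m _ ->].
by rewrite map_inj_uniq ?iota_uniq // => m n /addrI/eqP; rewrite eqr_nat => /eqP.
Qed.

(** Shifts preserve leading coefficients, so a nonzero [g] forces [b = b']; then [g] is periodic,
    hence constant. *)
Lemma ratfun_multiplier (b b' : R) g : b != 0 ->
  ratc b * fshift 1 g = ratc b' * g ->
  g = 0 \/ (b = b' /\ exists r, g = ratc r).
Proof.
have [p [q [q0 ->]]] := ratfunP g => b0.
have [->|p0] := eqVneq p 0; first by rewrite tofrac0 mul0r; left.
rewrite fshift_div // => e; right.
have q1 : pshift 1 q != 0 by rewrite pshift_eq0.
have {}e : b *: (pshift 1 p * q) = b' *: (p * pshift 1 q).
  apply/eqP; rewrite -tofrac_eq !tofracZ !tofracM; apply/eqP.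
  move: e; rewrite !mulrA => /eqP; rewrite eqr_div ?tofrac_eq0 // => /eqP ->.
  by [].
have eb : b = b'.
  have := congr1 lead_coef e.
  rewrite !lead_coefZ !lead_coefM !lead_coef_pshift; apply: mulIf.
  by rewrite mulf_neq0 // lead_coef_eq0.
split=> //; move: e; rewrite -eb => /(scalerI b0) e.
have [x qx] : exists x, q.[x] != 0.
  have /allPn[x _ qx] : ~~ all (root q) [seq m%:R | m <- iota 0 (size q)].
    apply/negP => h; have := max_poly_roots q0 h.
    rewrite size_map size_iota ltnn => /(_ _)/notF; apply.
    by rewrite map_inj_uniq ?iota_uniq // => m n /eqP; rewrite eqr_nat => /eqP.
  by exists x.
exists (p.[x] / q.[x]); have pq := poly_periodic_ratio qx e.
have -> : p = (p.[x] / q.[x]) *: q by rewrite mulrC -scalerA pq scalerK.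
rewrite tofracZ mulfK ?tofrac_eq0 //.
by rewrite hornerZ mulfK.
Qed.

(** A vanishing Casoratian would, by [cas_rcons_eq0] and [ratfun_multiplier], make the last
    polynomial a constant combination of earlier ones with the same base, whose sizes differ from
    each other and from its own. *)
Lemma cas_neq0 (s : seq (R * {poly R})) :
  (forall u, u \in s -> u.1 != 0 /\ u.2 != 0) ->
  uniq [seq (u.1, size u.2) | u : R * {poly R} <- s] ->
  cas (@fshift R 1) (map fseed s) != 0.
Proof.
elim/last_ind: s => [|s t IH] hs.
  by rewrite /cas /rowdet det_mx00 oner_eq0.
rewrite map_rcons rcons_uniq => /andP[tN us].
have hs' u : u \in s -> u.1 != 0 /\ u.2 != 0.
  by move=> us'; apply: hs; rewrite mem_rcons inE us' orbT.
have [t1 t2] : t.1 != 0 /\ t.2 != 0 by apply: hs; rewrite mem_rcons mem_head.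
have {}IH := IH hs' us.
apply/eqP; rewrite map_rcons => st0.
have [||r [rq]] := cas_rcons_eq0 (@fshiftN1K R) IH st0.
- move=> _ /mapP[u /hs'[u0 _] ->]; split; first exact: fshift_ratc.
  by rewrite /= tofrac_eq0 polyC_eq0.
- exact: fshift_ratc.
rewrite /=; set k := size _ in r rq *.
have kE : k = size s by rewrite /k size_map.
have nthE (i : 'I_k) : nth (0, 0) (map fseed s) i = fseed (nth (0, 0) s i).
  by rewrite (nth_map (0, 0)) // -kE.
have rR i : exists x, r i = ratc x /\ (x != 0 -> (nth (0, 0) s i).1 = t.1).
  have := rq i; rewrite nthE => /(ratfun_multiplier t1)[->|[e [x ->]]].
    by exists 0; rewrite /ratc tofrac0 eqxx.
  by exists x; split.
have [x xP] := fin_all_exists rR.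
rewrite (eq_bigr (fun i => tofrac (x i *: (nth (0, 0) s i).2))); last first.
  by move=> i _; rewrite nthE tofracZ; have [->] := xP i.
rewrite -rmorph_sum => /eqP; rewrite tofrac_eq => /eqP et.
have [j xj] : exists j, x j != 0.
  apply/existsP; apply: contraNT t2 => /existsPn h; rewrite et big1 // => i _.
  by have := h i; rewrite negbK => /eqP ->; rewrite scale0r.
pose P i : {poly R} := (nth (0, 0) s i).2.
(* The summands with nonzero coefficient have distinct sizes, so the sum has the size of the largest
   one. *)
pose m := [arg max_(i > j | x i != 0) size (P i)].
have [xm mmax] : x m != 0 /\ forall i, x i != 0 -> (size (P i) <= size (P m))%N.
  by rewrite /m; case: arg_maxnP.
have nm i : (i < k)%N -> nth (0, 0) s i \in s by rewrite kE => /(mem_nth (0,0)).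
suff e : size t.2 = size (P m).
  case/mapP: tN; exists (nth (0, 0) s m); first exact: nm.
  by rewrite e; have [_ /(_ xm) ->] := xP m.
rewrite et (bigD1 m) //= size_polyDl size_scale //.
have sm0 : (0 < size (P m))%N.
  by rewrite size_poly_gt0; have [] := hs' _ (nm _ (ltn_ord m)).
apply: (big_ind (fun p : {poly R} => size p < size (P m))%N).
- by rewrite size_poly0.
- by move=> p q hp hq; rewrite (leq_ltn_trans (size_polyD _ _)) // gtn_max hp.
move=> i im; have [->|xi] := eqVneq (x i) 0; first by rewrite scale0r size_poly0.
rewrite size_scale // ltn_neqAle mmax // andbT; apply: contraNneq im => e.
have eqb : (nth (0, 0) s i).1 = (nth (0, 0) s m).1.
  by have [_ /(_ xi) ->] := xP i; have [_ /(_ xm) ->] := xP m.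
apply/eqP/val_inj/eqP => /=.
rewrite -(nth_uniq (0, 0%N) _ _ us) ?size_map -?kE //.
by rewrite !(nth_map (0, 0)) -?kE // -/(P i) -/(P m) eqb e.
Qed.

End Casoratian.

(** * The difference equation and the degree of the Meixner polynomials *)

Section MeixnerEquation.
Variable R : numFieldType.
Implicit Types (p : {poly R}) (a c : R).

Lemma fact_unit (j : nat) : j`!%:R != 0 :> R.
Proof. by rewrite pnatr_eq0 -lt0n fact_gt0. Qed.

Lemma natS_div_fact (j : nat) : j.+1%:R / (j.+1)`!%:R = (j`!%:R)^-1 :> R.
Proof. by rewrite factS natrM invfM mulVKf ?pnatr_eq0. Qed.

Lemma binom_poly0 p : binom_poly p 0 = 1.
Proof. by rewrite /binom_poly big_ord0 fact0 invr1 scale1r. Qed.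

Lemma binom_polyS p j :
  j.+1%:R%:P * binom_poly p j.+1 = (p - j%:R%:P) * binom_poly p j.
Proof.
rewrite /binom_poly big_ord_recr /= mul_polyC scalerA natS_div_fact -scalerAr.
by congr (_ *: _); rewrite mulrC.
Qed.

Lemma binom_polyD1 p j :
  j.+1%:R%:P * binom_poly (p + 1) j.+1 = (p + 1) * binom_poly p j.
Proof.
rewrite /binom_poly big_ord_recl /= mul_polyC scalerA -scalerAr subr0.
congr (_ *: (_ * _)).
  by rewrite natS_div_fact.
by apply: eq_bigr => i _; rewrite /bump add1n -addn1 natrD polyCD; ring.
Qed.

Lemma natS_polyC_neq0 j : j.+1%:R%:P != 0 :> {poly R}.
Proof. by rewrite polyC_eq0 pnatr_eq0. Qed.

Lemma binom_poly_pascal p j :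
  binom_poly (p + 1) j.+1 = binom_poly p j.+1 + binom_poly p j.
Proof.
apply: (mulfI (natS_polyC_neq0 j)).
rewrite mulrDr binom_polyD1 binom_polyS -addn1 natrD polyCD; ring.
Qed.

Lemma binom_poly_absorb p j :
  p * binom_poly (p - 1) j = (p - j%:R%:P) * binom_poly p j.
Proof. by rewrite -binom_polyS -{1}[p](subrK 1) -binom_polyD1 subrK. Qed.

Definition meixner_term c n j : {poly R} :=
  binom_poly 'X j * binom_poly (- 'X - c%:P) (n - j).

(** Absorption followed by Pascal's rule turns each shifted term into the term itself and one
    neighbour: [j.+1] for the backward shift, [j.-1] for the forward one. *)
Lemma meixner_term_eq a c n j : (j <= n)%N ->
  'X * pshift (-1) (meixner_term c n j)
  - ((1 + a%:P) * 'X + a%:P * c%:P) * meixner_term c n j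
  + a%:P * ('X + c%:P) * pshift 1 (meixner_term c n j)
  = (a%:P * (n - j)%:R%:P - j%:R%:P) * meixner_term c n j
    + (if (j < n)%N then j.+1%:R%:P * meixner_term c n j.+1 else 0)
    - a%:P * (if j is i.+1 then (n - i)%:R%:P * meixner_term c n i else 0).
Proof.
move=> lejn; set Y := - 'X - c%:P : {poly R}.
have shb l p k : pshift l (binom_poly p k) = binom_poly (pshift l p) k.
  rewrite /binom_poly pshiftZ /pshift rmorph_prod; congr (_ *: _).
  by apply: eq_bigr => i _; rewrite rmorphB /= comp_polyC.
have shY l : pshift l Y = Y - (l%:~R)%:P.
  by rewrite /Y /pshift !rmorphB rmorphN /= comp_polyX comp_polyC; ring.
rewrite /meixner_term !pshiftM !shb !shY !pshiftX.
have -> : ((-1)%:~R)%:P = -1 :> {poly R} by rewrite -polyCN.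
rewrite polyC1 opprK.
rewrite -/Y; set i := (n - j)%N.
have XcE : 'X + c%:P = - Y by rewrite /Y; ring.
have -> : 'X * (binom_poly ('X - 1) j * binom_poly (Y + 1) i)
  = ('X - j%:R%:P) * binom_poly 'X j * binom_poly (Y + 1) i.
  by rewrite mulrA binom_poly_absorb.
have -> : a%:P * ('X + c%:P) * (binom_poly ('X + 1) j * binom_poly (Y - 1) i)
  = - a%:P * (binom_poly ('X + 1) j * ((Y - i%:R%:P) * binom_poly Y i)).
  by rewrite XcE -binom_poly_absorb; ring.
have -> : ('X - j%:R%:P) * binom_poly 'X j * binom_poly (Y + 1) i
  = ('X - j%:R%:P) * binom_poly 'X j * binom_poly Y i
  + (if (j < n)%N then j.+1%:R%:P * (binom_poly 'X j.+1 * binom_poly Y (n - j.+1))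
     else 0).
  (* For [j = n] the second binomial has index [0] and there is no neighbour. *)
  case: ltnP => [ltjn|lenj].
    have -> : i = (n - j.+1).+1 by rewrite /i; lia.
    by rewrite binom_poly_pascal mulrDr mulrA binom_polyS.
  have -> : i = 0%N by rewrite /i; lia.
  by rewrite !binom_poly0 addr0.
have -> : binom_poly ('X + 1) j * ((Y - i%:R%:P) * binom_poly Y i)
  = binom_poly 'X j * ((Y - i%:R%:P) * binom_poly Y i)
  + (if j is k.+1 then (n - k)%:R%:P * (binom_poly 'X k * binom_poly Y (n - k)) else 0).
  case: {shb} j lejn @i => [|k] lekn i; first by rewrite !binom_poly0 addr0.
  have -> : (n - k)%N = i.+1 by rewrite /i; lia.
  by rewrite binom_poly_pascal mulrDl -binom_polyS; congr (_ + _); rewrite mulrCA.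
move: (if (j < n)%N then _ else _) (match j with 0 => _ | _ => _ end) => U V.
have -> : Y = - 'X - c%:P by [].
by move: (binom_poly _ _) (binom_poly _ _) j%:R%:P i%:R%:P => b d J I; ring.
Qed.

(** This is [a - 1] times the operator [D] of the empty pair. *)
Definition meixner_op a c p : {poly R} :=
  'X * pshift (-1) p - ((1 + a%:P) * 'X + a%:P * c%:P) * p
  + a%:P * ('X + c%:P) * pshift 1 p.

Lemma meixner_opZ a c (k : R) p : meixner_op a c (k *: p) = k *: meixner_op a c p.
Proof. by rewrite /meixner_op !pshiftZ -!mul_polyC; ring. Qed.

Lemma meixner_op_sum a c k (F : 'I_k -> {poly R}) :
  meixner_op a c (\sum_i F i) = \sum_i meixner_op a c (F i).
Proof.
apply: (big_morph (meixner_op a c)) => [p q|].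
  by rewrite /meixner_op !pshiftD; ring.
by rewrite /meixner_op /pshift !comp_poly0 !mulr0 subr0 addr0.
Qed.

(** Reindexing the neighbour sums of [meixner_term_eq] gives multiples of the sums weighted by [j]
    and by [n - j]; these weights add up to [n]. *)
Lemma meixner_eq a c n : a != 0 ->
  meixner_op a c (meixner a c n) = ((a - 1) * n%:R) *: meixner a c n.
Proof.
move=> a0; rewrite /meixner; move: (_ / _) => k.
rewrite meixner_opZ scalerA [_ * k]mulrC -scalerA; congr (_ *: _).
rewrite meixner_op_sum; pose T := meixner_term c n.
pose U j := (a ^- j * j%:R) *: T j; pose V j := (a ^- j * (n - j)%:R) *: T j.
pose G j := if (j < n)%N then j.+1%:R%:P * T j.+1 else 0.
pose H j := if j is i.+1 then (n - i)%:R%:P * T i else 0.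
transitivity (\sum_(j < n.+1) (a *: V j - U j + a ^- j *: G j - (a ^- j * a) *: H j)).
  apply: eq_bigr => j _; rewrite meixner_opZ.
  have /(meixner_term_eq a c) e : (j <= n)%N by rewrite -ltnS.
  rewrite [meixner_op _ _ _]e -/T -/(G j) -/(H j) /U /V.
  by rewrite -!mul_polyC !polyCM; ring.
have GE : \sum_(j < n.+1) a ^- j *: G j = a *: \sum_(j < n.+1) U j.
  rewrite big_ord_recr /= {2}/G ltnn scaler0 addr0 [in RHS]big_ord_recl.
  rewrite /U mulr0 scale0r add0r scaler_sumr; apply: eq_bigr => j _.
  rewrite /G ltn_ord mul_polyC lift0 !scalerA; congr (_ *: _).
  by rewrite mulrA -[a ^- _.+1]exprVn exprS mulVKf // exprVn.
have HE : \sum_(j < n.+1) (a ^- j * a) *: H j = \sum_(j < n.+1) V j.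
  have Vn : V (@ord_max n) = 0 by rewrite /V /= subnn mulr0 scale0r.
  rewrite big_ord_recl [H _]/= scaler0 add0r [in RHS]big_ord_recr Vn [RHS]addr0.
  apply: eq_bigr => j _.
  rewrite /H lift0 /V mul_polyC !scalerA; congr (_ *: _).
  by rewrite -[a ^- _.+1]exprVn exprSr mulfVK // exprVn.
rewrite sumrB big_split HE GE /= sumrB -scaler_sumr.
transitivity ((a - 1) *: (\sum_(j < n.+1) U j + \sum_(j < n.+1) V j)).
  by rewrite -!mul_polyC; ring.
rewrite -scalerA; congr (_ *: _); rewrite -big_split scaler_sumr.
apply: eq_bigr => j _; rewrite /U /V /= -scalerDl -mulrDr -natrD subnKC; last by rewrite -ltnS.
by rewrite mulrC -scalerA.
Qed.

Lemma binom_polyP p j : size p = 2 ->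
  size (binom_poly p j) = j.+1 /\
  lead_coef (binom_poly p j) = lead_coef p ^+ j / j`!%:R.
Proof.
move=> sp; have szB (x : R) : size (p - x%:P) = 2 /\ lead_coef (p - x%:P) = lead_coef p.
  have lt1 : (size (- x%:P : {poly R}) < size p)%N.
    by rewrite sp size_polyN ltnS size_polyC_leq1.
  by rewrite size_polyDl // lead_coefDl.
rewrite /binom_poly size_scale ?invr_eq0 ?fact_unit //.
rewrite lead_coefZ mulrC lead_coef_prod; split.
  rewrite size_prod => [|i _]; last by rewrite -size_poly_gt0 (szB _).1.
  rewrite (eq_bigr (fun=> 2)) => [|i _]; last exact: (szB _).1.
  by rewrite sum_nat_const card_ord; lia.
congr (_ / _); rewrite (eq_bigr (fun=> lead_coef p)) => [|i _]; last exact: (szB _).2.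
by rewrite prodr_const card_ord.
Qed.

(** By the binomial theorem the coefficient of degree [n] of the sum is [(a^-1 - 1) ^+ n / n!],
    nonzero since [a] is not [1]. *)
Lemma size_meixner a c n : a != 0 -> a != 1 -> size (meixner a c n) = n.+1.
Proof.
move=> a0 a1; have a1' : 1 - a != 0 by rewrite subr_eq0 eq_sym.
rewrite size_scale; last by rewrite mulf_neq0 ?invr_eq0 ?expf_neq0.
have sY : size (- 'X - c%:P : {poly R}) = 2 /\ lead_coef (- 'X - c%:P : {poly R}) = -1.
  by rewrite -opprD size_polyN size_XaddC lead_coefN lead_coefXaddC.
have termP j : (j <= n)%N -> size (meixner_term c n j) = n.+1 /\
    (meixner_term c n j)`_n = (-1) ^+ (n - j) / j`!%:R / (n - j)`!%:R.
  move=> lejn; rewrite /meixner_term.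
  have [s1 l1] := binom_polyP j (size_polyX R).
  have [s2 l2] := binom_polyP (n - j) sY.1.
  have b1 : binom_poly ('X : {poly R}) j != 0 by rewrite -size_poly_gt0 s1.
  have b2 : binom_poly (- 'X - c%:P) (n - j) != 0 by rewrite -size_poly_gt0 s2.
  have sz : size (binom_poly 'X j * binom_poly (- 'X - c%:P) (n - j)) = n.+1.
    by rewrite size_mul // s1 s2 addSn /= addnS subnKC.
  split=> //; have := lead_coefM (binom_poly 'X j) (binom_poly (- 'X - c%:P) (n - j)).
  rewrite {1}/lead_coef sz /= => ->; rewrite l1 l2 sY.2 lead_coefX expr1n.
  by rewrite mul1r mulrCA mulrA.
apply/eqP; rewrite eqn_leq; apply/andP; split.
  apply: (leq_trans (size_sum _ _ _)); apply/bigmax_leqP => j _.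
  by apply: (leq_trans (size_scale_leq _ _)); rewrite (termP _ _).1 // -ltnS.
rewrite ltnNge; apply/negP => /leq_sizeP/(_ n (leqnn n))/eqP; apply/negP.
rewrite coef_sum.
have -> : \sum_(j < n.+1) (a ^- j *: meixner_term c n j)`_n = (a^-1 - 1) ^+ n / n`!%:R.
  rewrite addrC exprDn mulr_suml; apply: eq_bigr => j _.
  have lejn : (j <= n)%N by rewrite -ltnS.
  rewrite coefZ (termP _ lejn).2 -(bin_fact lejn) !natrM -[(_ * _) *+ _]mulr_natr exprVn.
  have := fact_unit j; have := fact_unit (n - j).
  have : 'C(n, j)%:R != 0 :> R by rewrite pnatr_eq0 -lt0n bin_gt0.
  move: ((-1) ^+ (n - j)) (a ^- j) 'C(n, j)%:R j`!%:R (n - j)`!%:R => u v x y z x0 z0 y0.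
  by field; do !(apply/andP; split).
rewrite mulf_neq0 ?invr_eq0 ?fact_unit ?expf_neq0 // subr_eq0.
by apply: contraNneq a1 => e; rewrite -[a]invrK e invr1.
Qed.

End MeixnerEquation.

(** * Maxima and sums of finite sets of indices *)

Section Indices.
Implicit Types S : {fset nat}.

(** For a pair [H], [max2 H] is [fmax H.2] by conversion. *)
Definition fmax S : nat := \max_(f <- S) f.

Lemma fmax_ge S f : f \in S -> (f <= fmax S)%N.
Proof. by move=> fS; rewrite /fmax (big_rem f) //= leq_maxl. Qed.

Lemma fmax_mem S : S != fset0 -> fmax S \in S.
Proof.
rewrite -cardfs_gt0.
suff maxs (s : seq nat) : (0 < size s)%N -> \max_(f <- s) f \in s by exact: maxs.
elim: s => // y [|z s] IH _; first by rewrite big_seq1 mem_head.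
rewrite big_cons; move: (IH isT); move: (\max_(f <- _) f) => m ms.
by rewrite inE; case: (leqP y m); rewrite ?eqxx ?ms ?orbT.
Qed.

(** This puts the seed of the removed index in the last row, the form needed by the lemmas about
    [rcons]. *)
Lemma sort_fmax S : S != fset0 ->
  sort leq S = rcons (sort leq (S `\ fmax S)%fset) (fmax S).
Proof.
move=> S0; set m := fmax S; have mS : m \in S := fmax_mem S0.
apply: (@sorted_eq _ leq); first exact: leq_trans.
- exact: anti_leq.
- exact: (sort_sorted leq_total).
- have : sorted leq (sort leq (S `\ m)%fset) by exact: (sort_sorted leq_total).
  have : all (fun x => x <= m)%N (sort leq (S `\ m)%fset).
    by apply/allP => x; rewrite mem_sort => /fsetD1P[_ /fmax_ge].
  move: (sort _ _) => s sm; case: s sm => //= x s /andP[xm sm] xs.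
  rewrite rcons_path xs /=; case/lastP: s sm xs => //= s y.
  by rewrite last_rcons all_rcons => /andP[].
- rewrite perm_sort perm_sym -cats1 perm_catC /=.
  apply: uniq_perm => //=.
    by rewrite mem_sort sort_uniq fset_uniq andbT !inE eqxx.
    exact: fset_uniq.
  by move=> x; rewrite inE mem_sort !inE; case: eqVneq => [->|].
Qed.

Lemma fset_card_le_max S : (forall f, f \in S -> (0 < f)%N) ->
  (#|` S| <= fmax S)%N.
Proof.
move=> pos; rewrite -(size_iota 1 (fmax S)); apply: uniq_leq_size => //.
by move=> x xS; rewrite mem_iota pos //= add1n ltnS fmax_ge.
Qed.

(** Induction removing the maximum, which is at least the cardinality. The bound makes the
    natural-number subtractions in [uH] exact. *)
Lemma fset_sum_ge S : (forall f, f \in S -> (0 < f)%N) ->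
  ('C(#|` S|.+1, 2) <= \sum_(f <- S) f)%N.
Proof.
move: {2}#|` S| (erefl #|` S|) => n; elim: n S => [|n IH] S eS pos.
  by rewrite eS.
have S0 : S != fset0 by rewrite -cardfs_gt0 eS.
have mS := fmax_mem S0; have mle := fset_card_le_max pos.
have e1 : #|` (S `\ fmax S)%fset| = n.
  by have := cardfsD1 (fmax S) S; rewrite mS eS add1n => -[].
rewrite (big_fsetD1 _ mS) /= eS binS bin1.
have := IH _ e1; rewrite e1 => /(_ _)h; rewrite addnC leq_add -?eS //.
by rewrite eS; apply: h => f /fsetD1P[_ /pos].
Qed.

End Indices.

Lemma sigmaHP (H : {fset nat} * {fset nat}) n :
  n \in sigmaH H -> (uH H <= n)%N /\ (n - uH H)%N \notin H.1.
Proof.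
rewrite inE => /andP[un nN]; split=> //; apply: contra nN => h.
by apply/mapP; exists (n - uH H)%N => //; lia.
Qed.

(** * Effect on the indices of removing the largest element of the second set *)

Section RemoveMax.
Variable F : {fset nat} * {fset nat}.
Hypotheses (F1_pos : forall f : nat, f \in F.1 -> (0 < f)%N)
  (F2_pos : forall f : nat, f \in F.2 -> (0 < f)%N) (F2_neq0 : F.2 != fset0).

Let F' := rem_max2 F.

Lemma cardH2_rem : cardH2 F = (cardH2 F').+1.
Proof. by rewrite /cardH2 (cardfsD1 (fmax F.2)) fmax_mem. Qed.

Lemma cardH_rem : cardH F = (cardH F').+1.
Proof. by rewrite /cardH cardH2_rem addnS. Qed.

Lemma cardH2_le_max2 : (cardH2 F <= max2 F)%N.
Proof. exact: fset_card_le_max. Qed.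

(** Removing the maximum lowers the sum by [max2 F] and ['C(cardH2 F, 2)] by [cardH2 F']. *)
Lemma uH_rem : (uH F + cardH2 F' = uH F' + max2 F)%N.
Proof.
have pos' f : f \in (F.2 `\ max2 F)%fset -> (0 < f)%N by case/fsetD1P => _ /F2_pos.
have h1 := fset_sum_ge F1_pos; have h2 := fset_sum_ge F2_pos.
have h3 := fset_sum_ge pos'.
have e2 : (\sum_(f <- F.2) f = max2 F + \sum_(f <- (F.2 `\ max2 F)%fset) f)%N.
  exact: (big_fsetD1 _ (fmax_mem F2_neq0)).
have k2 := cardH2_rem; have le := cardH2_le_max2.
rewrite /uH; change (F'.1) with F.1; change (F'.2) with (F.2 `\ max2 F)%fset.
change (cardH1 F') with (cardH1 F).
move: h1 h2 h3; rewrite -/(cardH1 F) -/(cardH2 F) -/(cardH2 F') k2 !binS !bin1 !bin0.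
move: k2 le; rewrite e2; lia.
Qed.

(** The index shift of the theorem preserves the offset from [uH], hence the Meixner polynomial in
    the first row. *)
Lemma tauE n : (uH F <= n)%N -> (n + cardH2 F - 1 - max2 F = n - uH F + uH F')%N.
Proof. have := uH_rem; have := cardH2_rem; lia. Qed.

Lemma sigma_tau n : (uH F <= n)%N ->
  (n \in sigmaH F) = (n - uH F + uH F' \in sigmaH F')%N.
Proof.
move=> un; rewrite !inE un leq_addl /=; congr (~~ _).
apply/mapP/mapP => -[f fF e]; exists f => //; change (F'.1) with F.1 in *; lia.
Qed.

End RemoveMax.

(** * Meixner seeds: Casoratians, independence and eigenvalues *)

Section MeixnerSeeds.
Variables (R : numFieldType) (a c : R).
Hypotheses (a0 : a != 0) (a1 : a != 1).
Implicit Type H : {fset nat} * {fset nat}.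

Local Notation sig := (@fshift R 1).

(** The base [a^-1] encodes the factor [a ^ -x] of the second family, whose shifts yield the
    divisors [a ^+ j] in the rows. *)
Definition mseeds H : seq (R * {poly R}) :=
  [seq (1, meixner a c f) | f <- sort leq H.1] ++
  [seq (a^-1, meixner a^-1 c f) | f <- sort leq H.2].

Definition kseeds H := map (@fseed R) (mseeds H).

Lemma size_kseeds H : size (kseeds H) = cardH H.
Proof. by rewrite /kseeds size_map size_cat !size_map !size_sort. Qed.

Lemma trow_fseed u j : trow sig (fseed u) j = tofrac (u.1 ^+ j *: pshift j u.2).
Proof. by rewrite /trow iter_fshift /= fshift_tofrac tofracZ rmorphXn. Qed.

Lemma nth_rows H i j : (i < cardH H)%N ->
  tofrac (nth (fun=> 0) (rows a c H) i j)
  = nth (fun=> 0) (map (trow sig) (kseeds H)) i j.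
Proof.
move=> lti; rewrite (nth_map (0, 0)) ?size_kseeds // (nth_map (0, 0)); last first.
  by rewrite -size_kseeds size_map in lti.
rewrite trow_fseed; congr tofrac; rewrite /rows /mseeds !nth_cat !size_map.
case: ltnP => h.
  by rewrite !(nth_map 0%N) //= expr1n scale1r.
have h2 : (i - size (sort leq H.1) < size (sort leq H.2))%N.
  by rewrite ltn_subLR // !size_sort.
by rewrite !(nth_map 0%N) //= exprVn.
Qed.

Lemma tofrac_det_rows k (rs : seq (nat -> {poly R})) (rs' : seq (nat -> ratfun R)) col :
  (forall i j, (i < k)%N ->
     tofrac (nth (fun=> 0) rs i j) = nth (fun=> 0) rs' i j) ->
  tofrac (det_rows k rs col) = rowdet k rs' col.
Proof.
move=> e; rewrite /det_rows /rowdet -det_map_mx; congr (\det _).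
by apply/matrixP => i j; rewrite !mxE; apply: e.
Qed.

Lemma tofrac_Omega H : tofrac (Omega a c H) = cas sig (kseeds H).
Proof.
rewrite /cas size_kseeds; apply: tofrac_det_rows => i j lti.
exact: nth_rows.
Qed.

Lemma tofrac_Lambda H : tofrac (Lambda a c H) = skipcas sig (kseeds H).
Proof.
rewrite /Lambda /skipcas size_kseeds; case: eqVneq => [|k0]; first by rewrite tofrac0.
rewrite (@tofrac_det_rows _ _ (map (trow sig) (kseeds H))); last first.
  by move=> i j; apply: nth_rows.
apply: eq_rowdet => i j lti ltj; congr (nth _ _ _ _); rewrite /bump.
(* Both relabellings send [k.-1] to [k] and fix the smaller labels. *)
case: eqP => [->|/eqP jk]; first by rewrite leqnn add1n prednK // lt0n.
by rewrite leqNgt ltn_neqAle jk -ltnS prednK ?lt0n // ltj.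
Qed.

Lemma tofrac_meixnerH H n :
  tofrac (meixnerH a c H n)
  = casop sig (kseeds H) 1 (tofrac (meixner a c (n - uH H))).
Proof.
rewrite /meixnerH /casop size_kseeds; apply: tofrac_det_rows => -[|i] j lti /=.
  by rewrite /trow /= expr1n mul1r iter_fshift fshift_tofrac.
exact: nth_rows.
Qed.

Lemma mseeds_neq0 H u : u \in mseeds H -> u.1 != 0 /\ u.2 != 0.
Proof.
have av0 : a^-1 != 0 by rewrite invr_eq0.
have av1 : a^-1 != 1 by rewrite invr_eq1.
rewrite mem_cat => /orP[] /mapP[f _ ->] /=; rewrite -size_poly_gt0.
  by rewrite oner_eq0 size_meixner.
by rewrite size_meixner.
Qed.

Lemma seeds_kseeds H : seeds sig (kseeds H).
Proof.
move=> _ /mapP[u uH ->]; split; first exact: fshift_ratc.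
by rewrite /= fmorph_eq0; have [] := mseeds_neq0 uH.
Qed.

(** Within a family the degrees differ; between the families the bases [1] and [a^-1] do. *)
Lemma uniq_mseeds H :
  uniq [seq (u.1, size u.2) | u : R * {poly R} <- mseeds H].
Proof.
have av0 : a^-1 != 0 by rewrite invr_eq0.
have av1 : a^-1 != 1 by rewrite invr_eq1.
rewrite map_cat -!map_comp cat_uniq !map_inj_in_uniq ?sort_uniq ?fset_uniq ?andbT /=.
- apply/hasPn => _ /mapP[f _ ->]; apply/mapP => -[g _ /= [e _]].
  by rewrite e eqxx in av1.
- by move=> f g _ _ /= []; rewrite !size_meixner // => -[].
- by move=> f g _ _ /= []; rewrite !size_meixner // => -[].
Qed.

Lemma cas_kseeds_neq0 H : cas sig (kseeds H) != 0.
Proof. exact: (cas_neq0 (@mseeds_neq0 H) (uniq_mseeds H)). Qed.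

(** Up to sign this is the Casoratian with one more seed, whose base and degree are new because [n]
    is outside [H.1]. *)
Lemma casop_kseeds_neq0 H n : n \notin H.1 ->
  casop sig (kseeds H) 1 (tofrac (meixner a c n)) != 0.
Proof.
move=> nH; have av1 : a^-1 != 1 by rewrite invr_eq1.
have av0 : a^-1 != 0 by rewrite invr_eq0.
have : cas sig (map (@fseed R) (rcons (mseeds H) (1, meixner a c n))) != 0.
  apply: cas_neq0 => [u|].
    rewrite mem_rcons inE => /predU1P[->|/mseeds_neq0//].
    by rewrite oner_eq0 -size_poly_gt0 size_meixner.
  rewrite map_rcons rcons_uniq uniq_mseeds andbT /= size_meixner //.
  rewrite map_cat mem_cat -!map_comp; apply/negP => /orP[] /mapP[f fH] /=.
    by rewrite size_meixner // => -[ef]; rewrite ef -(mem_sort leq) fH in nH.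
  by case=> e _; rewrite -e eqxx in av1.
rewrite map_rcons cas_rcons mulf_eq0 signr_eq0 /= /fseed /=.
by rewrite rmorph1.
Qed.

(** [opA], [opB] and [opC] are the coefficients of [D] for the empty pair. *)
Definition opA : ratfun R := tofrac 'X / ratc (a - 1).
Definition opB : ratfun R :=
  - (tofrac ((1 + a) *: 'X + (a * c)%:P) / ratc (a - 1)).
Definition opC : ratfun R := ratc a * tofrac ('X + c%:P) / ratc (a - 1).

Lemma iter_opC k :
  iter k sig opC = ratc a * tofrac ('X + (c + k%:R)%:P) / ratc (a - 1).
Proof.
rewrite iter_fshift /opC [LHS]rmorphM [X in X * _ = _]rmorphM fmorphV /= !fshift_ratc.
congr (_ * _ * _); rewrite fshift_tofrac pshiftD pshiftX pshiftC; congr tofrac.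
by rewrite polyCD addrAC addrA.
Qed.

Lemma iter_opB k :
  iter k sig opB =
  - (tofrac ((1 + a) *: ('X + k%:R%:P) + (a * c)%:P) / ratc (a - 1)).
Proof.
rewrite iter_fshift /opB [LHS]rmorphN [X in - X = _]rmorphM fmorphV /= !fshift_ratc.
by rewrite fshift_tofrac pshiftD pshiftZ pshiftX pshiftC.
Qed.

Lemma ratc_a1_neq0 : ratc (a - 1) != 0.
Proof. by rewrite fmorph_eq0 subr_eq0. Qed.

Lemma jac_clear (K : fieldType) (s s' : {rmorphism K -> K}) (x d q e b l y : K) :
  d != 0 -> b^-1 * (x * s' y) - q * y + b * (e * s y) = l * d * y ->
  jac s s' (x / d) (- (q / d)) (e / d) b y = l * y.
Proof.
rewrite /jac => d0 h; apply: (mulfI d0); rewrite [d * (l * y)]mulrA [d * l]mulrC -h.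
by move: b^-1 => b'; field.
Qed.

Lemma jac_poly (b l : R) (p : {poly R}) :
  b^-1 *: ('X * pshift (-1) p) - ((1 + a) *: 'X + (a * c)%:P) * p
    + (a * b) *: (('X + c%:P) * pshift 1 p) = (l * (a - 1)) *: p ->
  jac sig (@fshift R (-1)) opA opB opC (ratc b) (tofrac p) = ratc l * tofrac p.
Proof.
move=> e; apply: jac_clear; first exact: ratc_a1_neq0.
have -> : ratc l * ratc (a - 1) * tofrac p = tofrac ((l * (a - 1)) *: p).
  by rewrite tofracZ rmorphM.
rewrite /= !fshift_tofrac -e [RHS]tofracD [X in _ = X + _]tofracB (tofracZ b^-1).
rewrite (tofracZ (a * b)) !tofracM [ratc (a * b)]rmorphM fmorphV.
congr (_ + _).
by rewrite !mulrA [ratc b * _]mulrC.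
Qed.

Lemma jac_seed1 n :
  jac sig (@fshift R (-1)) opA opB opC 1 (tofrac (meixner a c n))
  = ratc n%:R * tofrac (meixner a c n).
Proof.
have -> : 1 = ratc 1 :> ratfun R by rewrite rmorph1.
apply: jac_poly.
rewrite invr1 scale1r mulr1 [n%:R * _]mulrC.
rewrite -(meixner_eq c n a0) /meixner_op -!mul_polyC !polyCD polyCM; ring.
Qed.

(** Multiplying the Meixner equation for [a^-1] by [a] gives the conjugated operator up to the
    constant [c * (1 - a)], the source of [c] in the Darboux parameter. *)
Lemma jac_seed2 n :
  jac sig (@fshift R (-1)) opA opB opC (ratc a^-1) (tofrac (meixner a^-1 c n))
  = ratc (- (c + n%:R)) * tofrac (meixner a^-1 c n).
Proof.
apply: jac_poly; rewrite invrK divff // scale1r.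
have av0 : a^-1 != 0 by rewrite invr_eq0.
have := congr1 (fun p => a *: p) (meixner_eq c n av0).
move: (meixner _ _ _) => m; rewrite /meixner_op scalerA mulrA mulrBr divff // mulr1.
move: (pshift 1 m) (pshift (-1) m) => m1 m2 e.
have ava : a%:P * a^-1%:P = 1 :> {poly R} by rewrite -polyCM divff.
transitivity (((1 - a) * n%:R) *: m + (c * (1 - a)) *: m); last first.
  by rewrite -scalerDl; congr (_ *: _); ring.
rewrite -e -!mul_polyC !polyCM !polyCD polyCN polyC1.
move: ava; move: (a%:P) (a^-1%:P) => x y xy.
by ring: xy.
Qed.

Lemma kseeds_eigen H u : u \in kseeds H ->
  exists2 l, const sig l &
    jac sig (@fshift R (-1)) opA opB opC u.1 u.2 = l * u.2.
Proof.
case/mapP => v; rewrite mem_cat => /orP[] /mapP[f _ ->] ->.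
  exists (ratc f%:R); first exact: fshift_ratc.
  by rewrite /= rmorph1 jac_seed1.
exists (ratc (- (c + f%:R))); first exact: fshift_ratc.
exact: jac_seed2.
Qed.

End MeixnerSeeds.

(** * The operators [D], [A] and [B] expressed through Casoratians of seeds *)

Lemma mulf_div2 (K : fieldType) (x w d v : K) : x * w / (d * v) = x / d * w / v.
Proof. by rewrite invfM; ring. Qed.

Lemma divf_neq0 (K : fieldType) (x y : K) : x != 0 -> y != 0 -> x / y != 0.
Proof. by move=> x0 y0; rewrite mulf_neq0 ?invr_eq0. Qed.

Lemma ratc_neq0 (R : fieldType) (r : R) : r != 0 -> ratc r != 0.
Proof. by rewrite fmorph_eq0. Qed.

Section MeixnerOperators.
Variables (R : numFieldType) (a c : R).
Hypotheses (a0 : a != 0) (a1 : a != 1).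
Implicit Type H : {fset nat} * {fset nat}.

Local Notation sig := (@fshift R 1).
Local Notation sig' := (@fshift R (-1)).
Local Notation kseeds := (kseeds a c).
Local Notation opA := (opA a).
Local Notation opB := (opB a c).
Local Notation opC := (opC a c).

Lemma OmegaF0 H : OmegaF a c H 0 = cas sig (kseeds H).
Proof. by rewrite /OmegaF tofrac_Omega fshift0. Qed.

Lemma OmegaF1 H : OmegaF a c H 1 = sig (cas sig (kseeds H)).
Proof. by rewrite /OmegaF tofrac_Omega. Qed.

Lemma h_m1E H : h_m1 a c H = crumA sig opA (kseeds H).
Proof. by rewrite /h_m1 OmegaF0 OmegaF1 mulf_div2. Qed.

Lemma h_1E H : h_1 a c H = crumC sig opC (kseeds H).
Proof. by rewrite /h_1 OmegaF0 OmegaF1 mulf_div2 /crumC iter_opC size_kseeds. Qed.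

Lemma h_0E H : h_0 a c H = crumB sig opB opC (kseeds H) + ratc (uH H)%:R.
Proof.
rewrite /h_0 OmegaF0 tofrac_Lambda mulf_div2 /crumB iter_opB size_kseeds.
rewrite -addrA [ratc _ + _]addrC addrA; congr (_ + _ + _).
rewrite /fwd; set G := (X in sig X - X); suff -> : G = crumG sig opC (kseeds H) by [].
rewrite /G /crumG iter_opC size_kseeds.
(* Without seeds [(cardH H).-1] is not [k - 1], but the factor [skipcas] is [0]. *)
have [k0|k0] := eqVneq (cardH H) 0%N.
  by rewrite /skipcas size_kseeds k0 eqxx !mulr0 !mul0r.
suff -> : c + (cardH H)%:R - 1 = c + (cardH H).-1%:R by [].
by rewrite -[in LHS](prednK (n := cardH H)) ?lt0n // -addn1 natrD addrA addrK.
Qed.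

Lemma DHE H g :
  DH a c H g = jac sig sig' (crumA sig opA (kseeds H))
    (crumB sig opB opC (kseeds H)) (crumC sig opC (kseeds H)) 1 g
  + ratc (uH H)%:R * g.
Proof.
rewrite /DH h_m1E h_0E h_1E fshift0 /jac invr1 !mul1r mulrDl.
by rewrite -!addrA; congr (_ + (_ + _)); rewrite addrC.
Qed.

(** Intertwining carries over the eigenvalue [n - uH H] of the first-row polynomial, and [DH] adds
    [uH H]. *)
Lemma DH_meixnerH H n : n \in sigmaH H ->
  DH a c H (tofrac (meixnerH a c H n))
  = ratc n%:R * tofrac (meixnerH a c H n).
Proof.
case/sigmaHP => un _; rewrite tofrac_meixnerH DHE.
rewrite (darboux_crum (@fshift1K R) (@fshiftN1K R) _ (@seeds_kseeds R a c a0 a1 H)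
  (cas_kseeds_neq0 c a0 a1 H) (@kseeds_eigen R a c a0 a1 H) (rmorph1 _) (oner_neq0 _)).
rewrite jac_seed1 // casopZ; last exact: fshift_ratc.
by rewrite -mulrDl -rmorphD -natrD subnK.
Qed.

Lemma meixnerH_neq0 H n : n \in sigmaH H -> tofrac (meixnerH a c H n) != 0.
Proof. by case/sigmaHP => un nN; rewrite tofrac_meixnerH casop_kseeds_neq0. Qed.

Section LastSeed.
Variable F : {fset nat} * {fset nat}.
Hypothesis F2_neq0 : F.2 != fset0.

Definition last_seed : ratfun R * ratfun R :=
  (ratc a^-1, tofrac (meixner a^-1 c (max2 F))).

Lemma kseeds_rem : kseeds F = rcons (kseeds (rem_max2 F)) last_seed.
Proof.
by rewrite /kseeds /mseeds (sort_fmax F2_neq0) map_rcons -rcons_cat map_rcons.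
Qed.

Lemma AFE g : AF a c F g = stepA sig (kseeds (rem_max2 F)) last_seed 1 g.
Proof.
rewrite /AF !OmegaF0 !OmegaF1 /stepA -kseeds_rem fshift0 mul1r /= fmorphV invfM.
by congr (_ * _ - _); rewrite mulrA; congr (_ / _); rewrite mulrC.
Qed.

Lemma BFE g : BF a c F g = stepB sig sig' opA opC (kseeds (rem_max2 F)) last_seed 1 g.
Proof.
rewrite /BF !OmegaF0 !OmegaF1 !mulf_div2 /stepB -kseeds_rem fshift0 invr1 mul1r.
rewrite /= fmorphV invrK /opA iter_opC size_kseeds (cardH_rem F2_neq0).
by rewrite -[in X in _ - X]addn1 natrD addrA addrK !mulrA.
Qed.

Let F' := rem_max2 F.

Let seedsS : seeds sig (rcons (kseeds F') last_seed).
Proof. by rewrite -kseeds_rem; apply: seeds_kseeds. Qed.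

Let casS : cas sig (rcons (kseeds F') last_seed) != 0.
Proof. by rewrite -kseeds_rem; apply: cas_kseeds_neq0. Qed.

Let eigS u : u \in rcons (kseeds F') last_seed ->
  exists2 l, const sig l & jac sig sig' opA opB opC u.1 u.2 = l * u.2.
Proof. by rewrite -kseeds_rem; exact: kseeds_eigen. Qed.

(** The eigenvalue of the last seed; adding [uH F'] or [uH F] gives the constants of the two
    factorizations. *)
Let lam := ratc (- (c + (max2 F)%:R)) : ratfun R.

Let eig_last : jac sig sig' opA opB opC last_seed.1 last_seed.2 = lam * last_seed.2.
Proof. exact: jac_seed2. Qed.

Let lamE (u : nat) (g : ratfun R) :
  lam * g + ratc u%:R * g = - (ratc (c + (max2 F)%:R - u%:R) * g).
Proof. by rewrite -mulrDl -rmorphD -mulNr -rmorphN; congr (ratc _ * _); ring. Qed.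

Lemma meixnerH_rem n n' : (n - uH F = n' - uH F')%N ->
  tofrac (meixnerH a c F n) = AF a c F (tofrac (meixnerH a c F' n')).
Proof.
move=> e; rewrite AFE !tofrac_meixnerH e kseeds_rem.
exact: (crum_rcons _ seedsS (cas_kseeds_neq0 c a0 a1 F') casS (rmorph1 _) (oner_neq0 _)).
Qed.

Lemma DH_rem_BA g :
  DH a c F' g = BF a c F (AF a c F g) - ratc (c + (max2 F)%:R - (uH F')%:R) * g.
Proof.
rewrite -lamE addrA AFE BFE DHE; congr (_ + _).
exact: (crum_BA (@fshift1K R) (@fshiftN1K R) g seedsS (cas_kseeds_neq0 c a0 a1 F')
  casS eigS (fshift_ratc 1 _) eig_last (rmorph1 _) (oner_neq0 _)).
Qed.

Lemma DH_AB g :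
  DH a c F g = AF a c F (BF a c F g) - ratc (c + (max2 F)%:R - (uH F)%:R) * g.
Proof.
rewrite -lamE addrA AFE BFE DHE kseeds_rem; congr (_ + _).
(* Any index outside [F.1] gives a Meixner polynomial that the determinant does not kill, as
   [crum_AB] requires. *)
have nF : (fmax F.1).+1 \notin F.1 by apply/negP => /fmax_ge; rewrite ltnn.
have := casop_kseeds_neq0 c a0 a1 nF; rewrite kseeds_rem => y0.
exact: (crum_AB (@fshift1K R) (@fshiftN1K R) g seedsS (cas_kseeds_neq0 c a0 a1 F')
  casS eigS (fshift_ratc 1 _) eig_last (rmorph1 _) (oner_neq0 _) (fshift_ratc 1 _)
  (jac_seed1 c a0 a1 _) y0 (rmorph1 _) (oner_neq0 _)).
Qed.

Lemma OmegaF_neq0 H l : OmegaF a c H l != 0.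
Proof. by rewrite fmorph_eq0 tofrac_Omega cas_kseeds_neq0. Qed.

Lemma first_order_AF : first_order (AF a c F).
Proof.
exists 0, (OmegaF a c F 1 / (ratc a * OmegaF a c F' 1)),
  (- (OmegaF a c F 0 / OmegaF a c F' 1)).
split=> [||g]; last by rewrite mulNr.
  apply: divf_neq0; first exact: OmegaF_neq0.
  by apply: mulf_neq0; [exact: ratc_neq0 | exact: OmegaF_neq0].
by rewrite oppr_eq0; apply: divf_neq0; exact: OmegaF_neq0.
Qed.

Lemma first_order_BF : first_order (BF a c F).
Proof.
exists (-1), (ratc a * tofrac 'X * OmegaF a c F' 1 / (ratc (a - 1) * OmegaF a c F 0)),
  (- (ratc a * tofrac ('X + (c + (cardH F)%:R - 1)%:P) * OmegaF a c F' 0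
      / (ratc (a - 1) * OmegaF a c F 0))).
have X0 (x : R) : tofrac ('X + x%:P) != 0.
  by rewrite tofrac_eq0 -size_poly_gt0 size_XaddC.
have d0 : ratc (a - 1) * OmegaF a c F 0 != 0.
  by apply: mulf_neq0; [exact: ratc_a1_neq0 | exact: OmegaF_neq0].
have n0 p l : tofrac p != 0 -> ratc a * tofrac p * OmegaF a c F' l != 0.
  move=> p0; apply: mulf_neq0; last exact: OmegaF_neq0.
  by apply: mulf_neq0; [exact: ratc_neq0 | exact: p0].
split=> [||g]; last by rewrite addNr mulNr.
  apply: divf_neq0; last exact: d0.
  by apply: n0; rewrite tofrac_eq0 polyX_eq0.
by rewrite oppr_eq0; apply: divf_neq0; [exact: (n0 _ _ (X0 _)) | exact: d0].
Qed.

End LastSeed.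

End MeixnerOperators.

(** * Assembly of the Darboux transform between the two Meixner systems *)

Theorem lemma3p4 (R : realType) (a c : R) (F : {fset nat} * {fset nat})
    (a_neq0 : a != 0) (a_neq1 : a != 1)
    (c_nonpole : forall i : nat, c != - i%:R)
    (F1_pos : forall f : nat, f \in F.1 -> (0 < f)%N)
    (F2_pos : forall f : nat, f \in F.2 -> (0 < f)%N)
    (F2_neq0 : F.2 != fset0) :
  let F' := rem_max2 F in
  let f := max2 F in
  let tau := fun n : nat => (n + cardH2 F - 1 - f)%N in
  [/\ forall n : nat, n \in sigmaH F ->
        tofrac (meixnerH a c F n) = AF a c F (tofrac (meixnerH a c F' (tau n))),
      forall g : ratfun R,
        DH a c F' g = BF a c F (AF a c F g) - ratc (c + f%:R - (uH F')%:R) * g,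
      forall g : ratfun R,
        DH a c F g = AF a c F (BF a c F g) - ratc (c + f%:R - (uH F)%:R) * g
    & exists Z : diffsystem R,
        darboux_transform (AF a c F) (BF a c F) (- (c + f%:R - (uH F')%:R))
          (meixner_system a c F') Z
        /\ reindexed tau ((uH F)%:R - (uH F')%:R) Z (meixner_system a c F)].
Proof.
move=> F' f tau.
have tauE' n : n \in sigmaH F -> (n - uH F = tau n - uH F')%N.
  by case/sigmaHP => un _; rewrite /tau tauE // addnK.
have mem_tau n : n \in sigmaH F -> tau n \in sigmaH F'.
  by move=> nF; have [un _] := sigmaHP nF; rewrite /tau tauE // -sigma_tau.
have eqA n : n \in sigmaH F ->
    tofrac (meixnerH a c F n) = AF a c F (tofrac (meixnerH a c F' (tau n))).
  by move=> nF; apply: meixnerH_rem => //; apply: tauE'.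
have eqAB := DH_AB c a_neq0 a_neq1 F2_neq0.
split=> //; first exact: DH_rem_BA.
(* The transform still carries the indices of [F']; the relabelling [tau] and an additive constant
   lead to the system of [F]. *)
exists (DiffSystem
  (fun g => AF a c F (BF a c F g) + ratc (- (c + f%:R - (uH F')%:R)) * g)
  (sigmaH F') (fun n => AF a c F (tofrac (meixnerH a c F' n)))).
split; split=> //=.
- exists (fun n => n%:R) => n nF' /=.
  by split; [exact: meixnerH_neq0 | exact: DH_meixnerH].
- by split; [exact: first_order_AF | exact: first_order_BF].
- by move=> g; rewrite rmorphN mulNr; exact: DH_rem_BA.
(* The constants of the two factorizations differ by [uH F - uH F']. *)
- move=> g; rewrite eqAB -[RHS]addrA -[X in _ = _ + X]mulrDl -rmorphD -mulNr -rmorphN.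
  by congr (_ + ratc _ * _); ring.
- move=> m n mF nF e; have [um _] := sigmaHP mF; have [un _] := sigmaHP nF.
  have := tauE' m mF; have := tauE' n nF; rewrite e; lia.
move=> n; split=> [nF'|[m /mem_tau mF <-] //].
have [un _] := sigmaHP nF'.
(* The preimage of [n] under [tau] is the index with the same offset, counted from [uH F]. *)
have um : (uH F <= n - uH F' + uH F)%N by rewrite leq_addl.
have tm : tau (n - uH F' + uH F)%N = n by rewrite /tau tauE // addnK subnK.
exists (n - uH F' + uH F)%N => //.
by rewrite sigma_tau // addnK subnK.
Qed.
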